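(* Let $n$ be an even integer greater than two, let $u_0\in\mathbb{R}$ be a constant, and let $U=(u_1(q,t),\dots,u_n(q,t))$ be a smooth real solution, defined on $\mathbb{S}^1(q)\times\mathbb{R}(t)$, of the quasi-linear system $$(u_k)_t=(n-k+1)\,u_{k-1}\,(u_1)_q-(u_{k+1})_q,\qquad k=1,\dots,n,\qquad u_{n+1}\equiv 0,$$ written in the form $U_t=A(U)U_q$. Suppose that: (a) for every $(q,t)\in\mathbb{S}^1\times\mathbb{R}$ the $n\times n$ matrix $A(U(q,t))$ has no real eigenvalues; (b) there is a constant $K>0$ such that $\int_{\mathbb{S}^1}\big((u_1)_q(q,t)\big)^2\,dq<K$ for all $t\in\mathbb{R}$. Then $U$ is constant, i.e. each $u_k$ is a constant function on $\mathbb{S}^1\times\mathbb{R}$.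
   Context: Here $\mathbb{S}^1=\mathbb{R}/\mathbb{Z}$, and subscripts $q,t$ denote partial derivatives. The matrix $A(U)$ is the $n\times n$ matrix (depending on $U$ and the constant parameter $u_0$) for which the displayed system reads $U_t=A(U)U_q$ with $U$ regarded as a column vector: its $k$-th row has the contribution $(n-k+1)u_{k-1}$ in column $1$, and the contribution $-1$ in column $k+1$ (if $k<n$), all other entries being zero. *)

(* Defs.v *)
From HB Require Import structures.
From mathcomp Require Import all_boot all_order all_algebra.
From mathcomp Require Import all_classical all_reals all_analysis.

Set Implicit Arguments.
Unset Strict Implicit.
Unset Printing Implicit Defensive.

Import Order.TTheory GRing.Theory Num.Theory.
Import numFieldNormedType.Exports.

Local Open Scope classical_set_scope.
Local Open Scope ring_scope.

(* Functions on the cylinder S^1(q) x R(t), with S^1 = R/Z, are represented by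
   functions of (q, t) in R x R that are 1-periodic in q. *)

Definition partial_q {R : realType} (f : R -> R -> R) : R -> R -> R :=
  partial1of2 f.

Definition partial_t {R : realType} (f : R -> R -> R) : R -> R -> R :=
  fun q t => derive1 (f q) t.

(* Derivability is required explicitly because derive1 is a total operator.
   Continuity is joint continuity in (q, t). *)
Fixpoint class_C {R : realType} (m : nat) (f : R -> R -> R) : Prop :=
  continuous (fun x : R * R => f x.1 x.2) /\
  if m is m'.+1 then
    [/\ forall q t, derivable (f^~ t) q 1,
        forall q t, derivable (f q) t 1,
        class_C m' (partial_q f) & class_C m' (partial_t f)]
  else True.

Definition smooth {R : realType} (f : R -> R -> R) : Prop :=
  forall m, class_C m f.

(* A vector v = (u_1, ..., u_n), whose k-th entry u_k is stored at the ordinal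
   k - 1, is extended to all indices k : nat by the constant u_0 at k = 0
   and by u_k = 0 for k > n. *)
Definition ext {R : realType} {n : nat} (u0 : R) (v : 'cV[R]_n) (k : nat) : R :=
  if k is k'.+1 then oapp (fun i : 'I_n => v i 0) 0 (insub k') else u0.

Definition field_component {R : realType} {n : nat} (u0 : R)
    (U : R -> R -> 'cV[R]_n) (k : nat) : R -> R -> R :=
  fun q t => ext u0 (U q t) k.

Definition solves_system {R : realType} {n : nat} (u0 : R)
    (U : R -> R -> 'cV[R]_n) : Prop :=
  let u := field_component u0 U in
  forall (k : nat) (q t : R), (1 <= k <= n)%N ->
    partial_t (u k) q t =
      (n - k + 1)%N%:R * u k.-1 q t * partial_q (u 1%N) q t
      - partial_q (u k.+1) q t.

(* Row i is row k = i + 1 in 1-based numbering, whence n - k + 1 = n - i and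
   u_(k-1) = ext u0 v i; column k + 1 in 1-based numbering is j = i + 1. *)
Definition system_matrix {R : realType} {n : nat} (u0 : R) (v : 'cV[R]_n)
    : 'M[R]_n :=
  \matrix_(i, j) (if j == 0 :> nat then (n - i)%N%:R * ext u0 v i
                  else if j == i.+1 :> nat then -1 else 0).

Lemma ext_ord {R : realType} {n : nat} (u0 : R) (v : 'cV[R]_n) (i : 'I_n) :
  ext u0 v i.+1 = v i 0.
Proof. by rewrite /ext insubT //= => ?; congr (v _ _); apply/val_inj. Qed.

Lemma ext_gt {R : realType} {n : nat} (u0 : R) (v : 'cV[R]_n) (k : nat) :
  (n < k)%N -> ext u0 v k = 0.
Proof. by case: k => [//|k] nk; rewrite /ext insubF // ltnNge -ltnS nk. Qed.

Lemma solves_systemE {R : realType} {n : nat} (u0 : R)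
    (U : R -> R -> 'cV[R]_n) :
  solves_system u0 U <->
  forall q t, \col_i partial_t (fun q t => U q t i 0) q t =
    system_matrix u0 (U q t) *m \col_i partial_q (fun q t => U q t i 0) q t.
Proof.
have cE (i : 'I_n) : field_component u0 U i.+1 = fun q t => U q t i 0.
  by apply/funext => q; apply/funext => t; exact: ext_ord.
have rowE (i : 'I_n) q t :
    (system_matrix u0 (U q t) *m
      \col_i partial_q (fun q t => U q t i 0) q t) i 0 =
    (n - i.+1 + 1)%N%:R * field_component u0 U i q t *
      partial_q (field_component u0 U 1) q t
    - partial_q (field_component u0 U i.+2) q t.
  have n0 : (0 < n)%N by exact: leq_ltn_trans (ltn_ord i).
  rewrite !mxE (bigD1 (Ordinal n0)) //= !mxE /= -(cE (Ordinal n0)).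
  rewrite addn1 subnSK //; congr (_ + _).
  have [ltn|gen] := ltnP i.+1 n.
    rewrite (bigD1 (Ordinal ltn)) //= !mxE /= eqxx mulN1r -(cE (Ordinal ltn)).
    rewrite big1 ?addr0 // => j /andP[j0 j1]; rewrite !mxE.
    have /negPf -> : (j : nat) != 0%N by apply: contra j0 => /eqP j0; apply/eqP/val_inj.
    have /negPf -> : (j : nat) != i.+1 by apply: contra j1 => /eqP j1; apply/eqP/val_inj.
    by rewrite mul0r.
  rewrite big1 => [|j j0]; last first.
    rewrite !mxE.
    have /negPf -> : (j : nat) != 0%N by apply: contra j0 => /eqP j0'; apply/eqP/val_inj.
    by rewrite ltn_eqF ?mul0r // (leq_trans (ltn_ord j)).
  have -> : field_component u0 U i.+2 = fun _ _ => 0.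
    by apply/funext => x; apply/funext => y; apply: ext_gt.
  by rewrite /partial_q /partial1of2 derive1_cst oppr0.
split=> [H q t|H u k q t].
  apply/matrixP => i j; rewrite (ord1 j) rowE mxE -cE.
  by rewrite H ?ltn_ord.
case: k => // k /= kn; have := H q t => /matrixP/(_ (Ordinal kn) 0).
by rewrite rowE mxE -(cE (Ordinal kn)).
Qed.

(* Main.v *)
Require Import Defs.
From HB Require Import structures.
From mathcomp Require Import all_boot all_order all_algebra.
From mathcomp Require Import all_classical all_reals all_analysis.
From mathcomp Require Import ring lra zify.
From mathcomp Require Import complex.

Import Order.TTheory GRing.Theory Num.Theory.
Import numFieldNormedType.Exports.
Local Open Scope classical_set_scope.
Local Open Scope ring_scope.

(** Write F(p, q, t) = p^(n+1)/(n+1) + u_0 p^n + u_1 p^(n-1) + ... + u_n and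
    P = F_p.  The system says that F_t + p F_q - (u_1)_q F_p = 0, that is, F is
    a first integral, polynomial in the momentum p, of the Hamiltonian
    p^2/2 + u_1(q, t) ([Fpoly_pde]).  A real root p of P gives the eigenvalue
    -p of A(U), with left eigenvector (p^(n-1), ..., p, 1)
    ([root_symbol_eigenvalue]); as n is even and P is monic of degree n, the
    absence of real eigenvalues means that P > 0 ([symbol_gt0]).

    The slope W = - F_q / P of the level curves of F then exists for all real p,
    and along the flow it satisfies the equation of Riccati
      W_t + p W_q - (u_1)_q W_p = - W^2 - (u_1)_qq,
    while
      (log P)_t = W - p (log P)_q + (u_1)_q (log P)_p.
    Let Y_N(t) and I_N(t) be the integrals of log P and of W over one period in
    q and over [-N, N] in p.  All terms that are q-derivatives integrate to zero
    by periodicity, so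
      Y_N' = I_N + boundary terms,
      I_N' = - (integral of W^2) + boundary terms,
    where the boundary terms sit at p = N and p = -N and are O(1/N), uniformly
    for t in a bounded interval ([boundary_small]).  Hence Y_N is almost concave
    in t.

    Besides, Y_N(t) >= 2 n (N log N - N) for all t ([Y_ge]): P splits into
    complex linear factors, and the integral over [-N, N] of
    log ((p - x)^2 + y^2) is at least 4 (N log N - N) for all x and all y <> 0
    ([integ_log_ge]).  At a fixed time this lower bound is attained up to a
    constant that does not depend on N ([Y_le]), because n is even and so the
    terms of order 1/N in log P(N) + log P(-N) cancel.  If W were nonzero
    somewhere at time t0, then almost concavity ([almost_concave_drop]) would
    make Y_N(t0 + T) or Y_N(t0 - T) drop below the lower bound when first T and
    then N are taken large enough.  Therefore W = 0, hence F_q = 0 as a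
    polynomial in p, all (u_k)_q vanish, and the system gives (u_k)_t = 0. *)

Set Implicit Arguments.
Unset Strict Implicit.
Unset Printing Implicit Defensive.

(** * Continuity of real-valued functions *)

Section Continuity.
Context {R : realType} {T : topologicalType}.
Implicit Types f g : T -> R.

Lemma cts_cst (k : R) : continuous (fun _ : T => k).
Proof. by move=> x; exact: cvg_cst. Qed.

Lemma ctsN f : continuous f -> continuous (fun x => - f x).
Proof. by move=> cf x; apply: cvgN; exact: cf. Qed.

Lemma ctsD f g : continuous f -> continuous g -> continuous (fun x => f x + g x).
Proof. by move=> cf cg x; apply: cvgD; [exact: cf|exact: cg]. Qed.

Lemma ctsB f g : continuous f -> continuous g -> continuous (fun x => f x - g x).
Proof. by move=> cf cg; apply: ctsD => //; exact: ctsN. Qed.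

Lemma ctsM f g : continuous f -> continuous g -> continuous (fun x => f x * g x).
Proof. by move=> cf cg x; apply: cvgM; [exact: cf|exact: cg]. Qed.

Lemma ctsV f : continuous f -> (forall x, f x != 0) ->
  continuous (fun x => (f x)^-1).
Proof. by move=> cf f0 x; apply: cvgV => //; exact: cf. Qed.

Lemma ctsX f m : continuous f -> continuous (fun x => f x ^+ m).
Proof.
move=> cf; elim: m => [|m IH]; first exact: cts_cst.
rewrite (_ : (fun x => _) = fun x => f x * f x ^+ m); first exact: ctsM.
by apply/funext => x; rewrite exprS.
Qed.

Lemma cts_sum (m : nat) (h : 'I_m -> T -> R) : (forall i, continuous (h i)) ->
  continuous (fun x => \sum_(i < m) h i x).
Proof.
elim: m h => [|m IH] h ch.
  rewrite (_ : (fun x => _) = fun=> 0); first exact: cts_cst.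
  by apply/funext => x; rewrite big_ord0.
rewrite (_ : (fun x => _) =
    fun x => \sum_(i < m) h (widen_ord (leqnSn m) i) x + h ord_max x).
  by apply: ctsD => //; exact: IH.
by apply/funext => x; rewrite big_ord_recr.
Qed.

Lemma cts_ln f : continuous f -> (forall x, 0 < f x) ->
  continuous (fun x => ln (f x)).
Proof.
move=> cf f0 x; apply: (@continuous_comp _ _ _ f (@ln R)); first exact: cf.
exact: continuous_ln.
Qed.

End Continuity.

(** * Integrals of continuous functions over compact intervals *)

Section Integral.
Context {R : realType}.
Implicit Types (f g F : R -> R) (a b c d x y : R).

(** The Lebesgue integral of [f] over [[a, b]]; it is zero when [b < a]. *)
Definition integ a b f : R :=
  (\int[lebesgue_measure]_(x in `[a, b]) f x)%R.

Lemma is_derive_continuous f (df : R -> R) :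
  (forall x, is_derive x 1 f (df x)) -> continuous f.
Proof.
move=> fdf x; apply: differentiable_continuous; apply/derivable1_diffP.
by case: (fdf x).
Qed.

Lemma cts_integrable f a b : continuous f ->
  lebesgue_measure.-integrable `[a, b] (EFin \o f).
Proof.
move=> cf; apply: continuous_compact_integrable; first exact: segment_compact.
exact: continuous_subspaceT.
Qed.

Lemma eq_integ a b f g : f =1 g -> integ a b f = integ a b g.
Proof. by move=> /funext ->. Qed.

Lemma integD a b f g : continuous f -> continuous g ->
  integ a b (fun x => f x + g x) = integ a b f + integ a b g.
Proof. by move=> cf cg; rewrite /integ RintegralD//; exact: cts_integrable. Qed.

Lemma integB a b f g : continuous f -> continuous g ->
  integ a b (fun x => f x - g x) = integ a b f - integ a b g.
Proof. by move=> cf cg; rewrite /integ RintegralB//; exact: cts_integrable. Qed.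

Lemma integZ a b k f : continuous f ->
  integ a b (fun x => k * f x) = k * integ a b f.
Proof. by move=> cf; rewrite /integ RintegralZl//; exact: cts_integrable. Qed.

Lemma integ_cst a b k : a <= b -> integ a b (cst k) = k * (b - a).
Proof.
move=> ab; rewrite /integ Rintegral_cst//=.
rewrite lebesgue_measure_itv/= lte_fin.
by move: ab; rewrite le_eqVlt => /predU1P[->|->]; rewrite ?ltxx ?subrr.
Qed.

Lemma le_integ a b f g : continuous f -> continuous g ->
  {in `[a, b], forall x, f x <= g x} -> integ a b f <= integ a b g.
Proof.
move=> cf cg fg; apply: le_Rintegral => //; try exact: cts_integrable.
Qed.

Lemma integ_ge0 a b f : (forall x, 0 <= f x) -> 0 <= integ a b f.
Proof. by move=> f0; apply: Rintegral_ge0. Qed.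

Lemma norm_integ_le a b f k : a <= b -> continuous f ->
  {in `[a, b], forall x, `|f x| <= k} -> `|integ a b f| <= k * (b - a).
Proof.
move=> ab cf fk.
have cC (m : R) : continuous (cst m : R -> R) by exact: cts_cst.
rewrite ler_norml -mulNr -!integ_cst//.
apply/andP; split; apply: le_integ => //= x /fk;
  by rewrite ler_norml => /andP[].
Qed.

Lemma integ_derive a b f F : a <= b -> continuous f ->
  (forall x, is_derive x 1 F (f x)) -> integ a b f = F b - F a.
Proof.
rewrite le_eqVlt => /predU1P[->|ab] cf Ff.
  by rewrite /integ set_itv1 Rintegral_set1 subrr.
have cF := is_derive_continuous Ff.
rewrite /integ /Rintegral (@continuous_FTC2 _ f F)//.
- exact: continuous_subspaceT.
- split.
  + by move=> x _; case: (Ff x).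
  + exact: cvg_at_right_filter (cF a).
  + exact: cvg_at_left_filter (cF b).
- by move=> x _; rewrite derive1E; case: (Ff x).
Qed.

Lemma integ_split a b c f : a <= b -> b <= c -> continuous f ->
  integ a c f = integ a b f + integ b c f.
Proof.
move=> ab bc cf.
have i0 : lebesgue_measure.-integrable `[a, c] (EFin \o f).
  exact: cts_integrable.
rewrite /integ; have := @Rintegral_itvB _ f (BLeft a) (BRight c) b i0.
rewrite !bnd_simp => /(_ ab bc) E.
apply/eqP; rewrite addrC -subr_eq E; apply/eqP.
rewrite Rintegral_itv_obnd_cbnd//.
by apply: integrableS (i0) => //; apply: subset_itvr; rewrite bnd_simp.
Qed.

Lemma integ_is_derive a f x : a < x -> continuous f ->
  is_derive x 1 (fun y => integ a y f) (f x).
Proof.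
move=> ax cf.
have xu : x < x + 1 by rewrite ltrDl.
have [D E] := continuous_FTC1_closed xu (@cts_integrable f a (x + 1) cf) ax (cf x).
by apply: DeriveDef; [exact: D|rewrite -derive1E; exact: E].
Qed.

(** The function [y |-> integ (- y) y f] is rewritten near [x] as a difference
    of integrals with one common fixed lower bound. *)
Lemma integ_sym_is_derive f x : 0 < x -> continuous f ->
  is_derive x 1 (fun y => integ (- y) y f) (f x + f (- x)).
Proof.
move=> x0 cf; pose A := - x - 1.
have e : \forall y \near x, integ A y f - integ A (- y) f = integ (- y) y f.
  have xI : x \in `]0, x + 1[ by rewrite in_itv/=; lra.
  near=> y; have : y \in `]0, x + 1[ by near: y; exact: near_in_itvoo.
  rewrite in_itv/= => /andP[y0 y1].
  rewrite (@integ_split A (- y) y)//; [|by rewrite /A; lra|by lra].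
  by rewrite addrAC subrr add0r.
apply: near_eq_is_derive e _.
have D1 : is_derive x 1 (fun y => integ A y f) (f x).
  by apply: integ_is_derive => //; rewrite /A; lra.
have D2 : is_derive (- x) 1 (fun y => integ A y f) (f (- x)).
  by apply: integ_is_derive => //; rewrite /A; lra.
have D3 : is_derive x 1 (-%R : R -> R) (- 1) by exact: is_deriveNid.
have D4 := is_derive1_comp D2 D3.
have := is_deriveB D1 D4; rewrite mulrN1 opprK; exact.
Unshelve. all: by end_near. Qed.

End Integral.

(** * Derivatives of functions of one real variable *)

Section Derivatives.
Context {R : realType}.
Implicit Types (f g : R -> R) (x a b : R).

Lemma drv_eq f x a b : is_derive x 1 f a -> a = b -> is_derive x 1 f b.
Proof. by move=> fa <-. Qed.

Lemma drv_cst (k x : R) : is_derive x 1 (fun _ : R => k) (0 : R).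
Proof. exact: is_derive_cst. Qed.

Lemma drv_id x : is_derive x 1 (fun y : R => y) (1 : R).
Proof. exact: is_derive_id. Qed.

Lemma drvN f x a : is_derive x 1 f a -> is_derive x 1 (fun y => - f y) (- a).
Proof. exact: is_deriveN. Qed.

Lemma drvD f g x a b : is_derive x 1 f a -> is_derive x 1 g b ->
  is_derive x 1 (fun y => f y + g y) (a + b).
Proof. exact: is_deriveD. Qed.

Lemma drvB f g x a b : is_derive x 1 f a -> is_derive x 1 g b ->
  is_derive x 1 (fun y => f y - g y) (a - b).
Proof. exact: is_deriveB. Qed.

Lemma drvM f g x a b : is_derive x 1 f a -> is_derive x 1 g b ->
  is_derive x 1 (fun y => f y * g y) (a * g x + f x * b).
Proof.
move=> fa gb; apply: drv_eq (is_deriveM fa gb) _.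
by rewrite /GRing.scale /= addrC; congr (_ + _); exact: mulrC.
Qed.

Lemma drvZ (k : R) f x a : is_derive x 1 f a ->
  is_derive x 1 (fun y => k * f y) (k * a).
Proof.
move=> fa; have H := drvM (drv_cst k x) fa.
by apply: (drv_eq H); rewrite mul0r add0r.
Qed.

Lemma drvX f m x a : is_derive x 1 f a ->
  is_derive x 1 (fun y => f y ^+ m) (m%:R * f x ^+ m.-1 * a).
Proof.
elim: m => [|m IH] fa.
  by have H := drv_cst 1 x; apply: (drv_eq H); rewrite !mul0r.
rewrite (_ : (fun y => _) = fun y => f y * f y ^+ m); last first.
  by apply/funext => y; rewrite exprS.
have H := drvM fa (IH fa); apply: (drv_eq H) => /=.
case: m {IH H} => [|m]; first by rewrite /=; ring.
by rewrite /= exprS -[in RHS]natr1; ring.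
Qed.

Lemma drv_sum (m : nat) (h : 'I_m -> R -> R) (dh : 'I_m -> R) x :
  (forall i, is_derive x 1 (h i) (dh i)) ->
  is_derive x 1 (fun y => \sum_(i < m) h i y) (\sum_(i < m) dh i).
Proof. by move=> hd; rewrite -fct_sumE; exact: is_derive_sum. Qed.

Lemma drv_comp f g x a b : is_derive (g x) 1 f a -> is_derive x 1 g b ->
  is_derive x 1 (fun y => f (g y)) (a * b).
Proof. exact: is_derive1_comp. Qed.

Lemma drv_ln f x a : 0 < f x -> is_derive x 1 f a ->
  is_derive x 1 (fun y => ln (f y)) (a / f x).
Proof.
move=> f0 fa; have H := drv_comp (is_derive1_ln f0) fa.
by apply: (drv_eq H); exact: mulrC.
Qed.

Lemma drv_div f g x a b : g x != 0 -> is_derive x 1 f a -> is_derive x 1 g b ->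
  is_derive x 1 (fun y => f y / g y) (a / g x - f x * b / g x ^+ 2).
Proof.
move=> g0 fa gb; have H := drvM fa (is_deriveV g0 gb); apply: (drv_eq H).
by rewrite /GRing.scale /=; field.
Qed.

Lemma drv_unique f x a b : is_derive x 1 f a -> is_derive x 1 f b -> a = b.
Proof. by move=> [_ <-] [_ <-]. Qed.

Lemma drv_ge0_le f (df : R -> R) a b : a <= b ->
  (forall x, a <= x -> x <= b -> is_derive x 1 f (df x)) ->
  (forall x, a <= x -> x <= b -> 0 <= df x) -> f a <= f b.
Proof.
move=> ab fd f0.
have [c|c|c] := @MVT_segment R f df a b ab.
- by rewrite in_itv/= => /andP[ac cb]; apply: fd; exact: ltW.
- apply: derivable_within_continuous => x; rewrite in_itv/= => /andP[ax xb].
  by case: (fd x ax xb).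
- rewrite in_itv/= => /andP[ac cb] E.
  by rewrite -subr_ge0 E mulr_ge0 ?f0// subr_ge0.
Qed.

End Derivatives.

(** * Integrals depending on a parameter *)

Section UnderIntegral.
Context {R : realType}.

(** By compactness of [[a, b]], [G x w] tends to [G x z] uniformly in [x] as
    [w] tends to [z]. *)
Lemma compact_uniform_near (T : topologicalType) (G : R -> T -> R) (a b e : R)
    (z : T) : continuous (fun x : R * T => G x.1 x.2) -> 0 < e ->
  \forall w \near z, {in `[a, b], forall x, `|G x z - G x w| < e}.
Proof.
move=> cG e0; have /compact_near_coveringP K := @segment_compact R a b.
have := K T (nbhs z) (fun w x => `|G x z - G x w| < e) _.
have H x : `[a, b]%classic x ->
    \forall x' \near x & w \near z, `|G x' z - G x' w| < e.
  move=> _; have e2 : 0 < e / 2 by rewrite divr_gt0.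
  have /cvgrPdist_lt/(_ _ e2)[[A B]/= [xA zB] AB] := cG (x, z).
  exists (A, B) => //= -[x' w]/= [Ax' Bw].
  have B1 := AB (x', w) (conj Ax' Bw).
  have B2 := AB (x', z) (conj Ax' (nbhs_singleton zB)).
  rewrite [ltRHS]splitr; apply: le_lt_trans (ltrD B2 B1) => /=.
  by rewrite [X in _ <= X + _]distrC; exact: ler_distD.
by move=> /(_ _ H); apply: filterS => w Hw x /Hw.
Qed.

Lemma continuous_section (T : topologicalType) (G : R -> T -> R) (z : T) :
  continuous (fun x : R * T => G x.1 x.2) -> continuous (G^~ z).
Proof.
move=> cG x; apply: (@continuous_comp _ _ _ (fun x => (x, z)) (fun w => G w.1 w.2)).
  have /= := @cvg_pair _ _ _ (nbhs x) (nbhs x) (nbhs z) _ _ _ id (fun=> z).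
  by apply; [exact: cvg_id|exact: cvg_cst].
exact: cG.
Qed.

Lemma continuous_integ (T : topologicalType) (G : R -> T -> R) (a b : R) :
  a <= b -> continuous (fun x : R * T => G x.1 x.2) ->
  continuous (fun z => integ a b (G^~ z)).
Proof.
move=> ab cG z; apply/cvgrPdist_lt => e e0.
have ba : 0 < b - a + 1 by lra.
have e1 : 0 < e / (b - a + 1) by rewrite divr_gt0.
have := compact_uniform_near a b z cG e1; apply: filterS => w Hw.
have cz y := @continuous_section T G y cG.
rewrite -integB//.
apply: (@le_lt_trans _ _ (e / (b - a + 1) * (b - a))).
  apply: norm_integ_le => //; last by move=> x /Hw/ltW.
  exact: ctsB.
by rewrite mulrAC ltr_pdivrMr// ltr_pM2l//; lra.
Qed.

(** Differentiation under the integral sign. The hypotheses on [G] are only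
    needed for parameters near [t]; this allows [G] to be an integral with a
    variable upper bound. *)
Lemma is_derive_integ_near (G G' : R -> R -> R) (a b t r : R) : a <= b ->
  0 < r -> (forall s, `|t - s| < r -> continuous (G^~ s)) ->
  (forall x s : R, `|t - s| < r -> is_derive s 1 (G x) (G' x s)) ->
  continuous (fun x : R * R => G' x.1 x.2) ->
  is_derive t 1 (fun s => integ a b (G^~ s)) (integ a b (G'^~ t)).
Proof.
move=> ab r0 cG dG cG'.
have cG't := @continuous_section R G' t cG'.
(* Caratheodory's criterion, applied to the difference quotient at t. *)
apply/is_derive1_caratheodory.
exists (fun s => if s == t then integ a b (G'^~ t) else
  (integ a b (G^~ s) - integ a b (G^~ t)) / (s - t)); split.
- move=> s; case: eqVneq => [->|st]; first by rewrite !subrr mulr0.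
  by rewrite divfK// subr_eq0.
- apply/cvgrPdist_lt => e e0; rewrite eqxx.
  have ba : 0 < b - a + 1 by lra.
  have e1 : 0 < e / (b - a + 1) by rewrite divr_gt0.
  have /nbhs_ballP[d /= d0 dH] := compact_uniform_near a b t cG' e1.
  have dr0 : 0 < Num.min d r by rewrite lt_min d0.
  apply/nbhs_ballP; exists (Num.min d r) => //= s.
  rewrite /ball/= lt_min => /andP[ts tr] /=.
  have [_|st] := eqVneq s t; first by rewrite subrr normr0.
  have st0 : s - t != 0 by rewrite subr_eq0.
  have cc : continuous (fun x => G x s - G x t).
    by apply: ctsB; apply: cG => //; rewrite subrr normr0.
  have cq : continuous (fun x => (s - t)^-1 * (G x s - G x t)).
    by apply: ctsM => //; exact: cts_cst.
  have cGt : continuous (G^~ t) by apply: cG; rewrite subrr normr0.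
  have cGs : continuous (G^~ s) by exact: cG.
  rewrite -integB//.
  rewrite mulrC -integZ// -integB//.
  apply: (@le_lt_trans _ _ (e / (b - a + 1) * (b - a))); last first.
    by rewrite mulrAC ltr_pdivrMr// ltr_pM2l//; lra.
  apply: norm_integ_le => //.
    exact: ctsB.
  move=> x xab.
  have [c [cd ->]] : exists c, `|t - c| < d /\ G x s - G x t = G' x c * (s - t).
    case: (ltgtP s t) st => // [st|ts'] _.
    - have I c : s <= c -> c <= t -> `|t - c| < r.
        by move=> sc ct; apply: le_lt_trans tr; rewrite !ger0_norm; lra.
      have [] := @MVT _ (G x) (G' x) s t st.
      + move=> c; rewrite in_itv/= => /andP[sc ct].
        by apply: dG; apply: I; exact: ltW.
      + apply: derivable_within_continuous => c; rewrite in_itv/= => /andP[sc ct].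
        by have [] := dG x c (I c sc ct).
      move=> c; rewrite in_itv/= => /andP[sc ct] E; exists c.
      split; first by apply: lt_trans ts; rewrite !gtr0_norm; lra.
      by rewrite -opprB E; ring.
    - have I c : t <= c -> c <= s -> `|t - c| < r.
        by move=> sc ct; apply: le_lt_trans tr; rewrite !ler0_norm; lra.
      have [] := @MVT _ (G x) (G' x) t s ts'.
      + move=> c; rewrite in_itv/= => /andP[sc ct].
        by apply: dG; apply: I; exact: ltW.
      + apply: derivable_within_continuous => c; rewrite in_itv/= => /andP[sc ct].
        by have [] := dG x c (I c sc ct).
      move=> c; rewrite in_itv/= => /andP[sc ct] E; exists c.
      by split => //; apply: lt_trans ts; rewrite !ltr0_norm; lra.
  rewrite mulrC mulfK//; apply/ltW/(dH c) => //.
- by rewrite eqxx.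
Qed.

Lemma is_derive_integ (G G' : R -> R -> R) (a b t : R) : a <= b ->
  (forall s, continuous (G^~ s)) ->
  (forall x s : R, is_derive s 1 (G x) (G' x s)) ->
  continuous (fun x : R * R => G' x.1 x.2) ->
  is_derive t 1 (fun s => integ a b (G^~ s)) (integ a b (G'^~ t)).
Proof.
move=> ab cG dG; apply: (is_derive_integ_near ab ltr01 (fun s _ => cG s)).
Qed.

(** Both sides, with [a] replaced by the fixed lower bound [a - 1] and
    regarded as functions of the upper bound [b], have the same derivative.
    The lower bound lies strictly to the left of [a] so that these functions
    are differentiable on all of [[a, b]]. *)
Lemma Fubini_integ (H : R -> R -> R) (a b c d : R) : a <= b -> c <= d ->
  continuous (fun x : R * R => H x.1 x.2) ->
  integ a b (fun x => integ c d (H x)) =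
  integ c d (fun y => integ a b (H^~ y)).
Proof.
move=> ab cd cH; pose A := a - 1.
have cHs : continuous (fun x : R * R => H x.2 x.1).
  move=> x; apply: (@continuous_comp _ _ _ (fun x => (x.2, x.1))
    (fun w => H w.1 w.2)); last exact: cH.
  exact: cvg_pair cvg_snd cvg_fst.
have cHx x : continuous (H x)
  by exact: (@continuous_section R (fun y x => H x y) x cHs).
have cHy y : continuous (H^~ y) by exact: (@continuous_section R H y cH).
have cV : continuous (fun x => integ c d (H x)).
  exact: (@continuous_integ R (fun y x => H x y) c d cd cHs).
have AM M : a <= M -> A < M by rewrite /A; lra.
have Aa : A <= a by rewrite ltW// AM.
pose Z M := integ A M (fun x => integ c d (H x)).
pose V M := integ c d (fun y => integ A M (H^~ y)).
have ZD M : a <= M -> M <= b -> is_derive M 1 (fun y => Z y - V y) 0.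
  move=> aM _.
  have H1 := @integ_is_derive R A (fun x => integ c d (H x)) M (AM M aM) cV.
  have r0 : 0 < M - A by rewrite subr_gt0 AM.
  have H2 : is_derive M 1 V (integ c d (fun y => H M y)).
    apply: (@is_derive_integ_near (fun y M => integ A M (H^~ y))
      (fun y M => H M y) c d M (M - A) cd r0 _ _ cHs).
    + move=> s /ltr_normlW sM; apply: (@continuous_integ R H) => //; lra.
    + move=> y s /ltr_normlW sM.
      by apply: (@integ_is_derive R A (H^~ y) s) => //; lra.
  have := drvB H1 H2; rewrite subrr; exact.
have ZV : Z a - V a = Z b - V b.
  apply/eqP; rewrite eq_le; apply/andP; split.
    by apply: (drv_ge0_le ab ZD).
  rewrite -lerN2; apply: (@drv_ge0_le _ (fun y => - (Z y - V y)) (fun=> - 0) a b ab).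
    by move=> M aM Mb; exact: drvN (ZD M aM Mb).
  by move=> *; rewrite oppr0.
have Zs : Z b = Z a + integ a b (fun x => integ c d (H x)) by exact: integ_split.
have Vs : V b = V a + integ c d (fun y => integ a b (H^~ y)).
  rewrite /V -integD; last 2 first.
  - exact: (@continuous_integ R H).
  - exact: (@continuous_integ R H).
  by apply: eq_integ => y; rewrite (integ_split Aa ab).
move: ZV; rewrite Vs Zs opprD addrACA => /eqP.
by rewrite -[eqbLHS]addr0 (inj_eq (addrI _)) eq_sym subr_eq0 => /eqP.
Qed.

End UnderIntegral.

(** * Symmetry of the mixed second derivatives *)

Section Schwarz.
Context {R : realType}.

Lemma class_C_cts m (f : R -> R -> R) : class_C m f ->
  continuous (fun x : R * R => f x.1 x.2).
Proof. by case: m => [|m] [cf _]; exact: cf. Qed.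

Lemma class_C_drv_q m (f : R -> R -> R) (q t : R) : class_C m.+1 f ->
  is_derive q 1 (f^~ t) (partial_q f q t).
Proof.
move=> [_ [d1 _ _ _]].
by apply: DeriveDef; [exact: d1|rewrite -partial1of2E].
Qed.

Lemma class_C_drv_t m (f : R -> R -> R) (q t : R) : class_C m.+1 f ->
  is_derive t 1 (f q) (partial_t f q t).
Proof.
move=> [_ [_ d2 _ _]].
by apply: DeriveDef; [exact: d2|rewrite /partial_t derive1E].
Qed.

(** Differentiate [f x t - f a t], written as the integral of [partial_q f]
    from [a] to [x], first under the integral sign in [t] and then in the
    upper bound [x]. *)
Lemma Schwarz_partial (f : R -> R -> R) (q t : R) : class_C 2 f ->
  partial_q (partial_t f) q t = partial_t (partial_q f) q t.
Proof.
move=> cf.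
have [cq ct] : class_C 1 (partial_q f) /\ class_C 1 (partial_t f).
  by move: cf => [_ [_ _ c1 c2]]; exact: (conj c1 c2).
have cqt : continuous (fun x : R * R => partial_t (partial_q f) x.1 x.2).
  by move: cq => [_ [_ _ _ [c _]]]; exact: c.
have cfq := class_C_cts cq.
pose a := q - 1.
have aq : a < q by rewrite /a; lra.
have E x s : a <= x -> f x s - f a s = integ a x ((partial_q f)^~ s).
  move=> ax; apply/esym/(@integ_derive R a x ((partial_q f)^~ s) (f^~ s) ax).
    exact: continuous_section cfq.
  by move=> y; exact: class_C_drv_q cf.
have E' x : a <= x -> partial_t f x t - partial_t f a t =
    integ a x ((partial_t (partial_q f))^~ t).
  move=> ax; apply: (@drv_unique _ (fun s => f x s - f a s) t).
    by apply: drvB; exact: class_C_drv_t cf.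
  rewrite (_ : (fun s => _) = fun s => integ a x ((partial_q f)^~ s)).
    apply: (is_derive_integ t ax _ _ cqt).
      by move=> s; exact: continuous_section cfq.
    by move=> y s; exact: class_C_drv_t cq.
  by apply/funext => s; exact: E.
apply: (@drv_unique _ (fun x => partial_t f x t - partial_t f a t) q).
  have H := drvB (class_C_drv_q q t ct) (drv_cst (partial_t f a t) q).
  by rewrite subr0 in H; exact: H.
have H := @integ_is_derive R a ((partial_t (partial_q f))^~ t) q aq
  (@continuous_section _ _ _ t cqt).
apply: near_eq_is_derive H.
have : q \in `]a, q + 1[ by rewrite in_itv/=; lra.
move=> /near_in_itvoo; apply: filterS => x.
by rewrite in_itv/= => /andP[/ltW/E' -> _].
Qed.

End Schwarz.

(** * Almost concave functions *)

Section AlmostConcave.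
Context {R : realType}.

Lemma drv_le_slope (f df : R -> R) (a b k : R) : a <= b ->
  (forall x, a <= x -> x <= b -> is_derive x 1 f (df x)) ->
  (forall x, a <= x -> x <= b -> df x <= k) -> f b <= f a + k * (b - a).
Proof.
move=> ab fd fk.
have D x : a <= x -> x <= b ->
    is_derive x 1 (fun y => k * y - f y) (k * 1 - df x).
  by move=> ax xb; exact: (drvB (drvZ k (drv_id x)) (fd x ax xb)).
have P x : a <= x -> x <= b -> 0 <= k * 1 - df x.
  by move=> ax xb; rewrite mulr1 subr_ge0; exact: fk.
by have := drv_ge0_le ab D P; lra.
Qed.

(** Here [Y'] is at most [I + h] and [I'] at most [h], and even at most [h - d]
    during the initial time [r]. If [I] starts nonpositive, then up to errors of
    order [h] it loses [d * r] during the time [r], and afterwards [Y] decreases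
    at least at that rate. *)
Lemma almost_concave_forward (Y I dY dI : R -> R) (T r d h : R) :
  0 <= r -> r <= T -> 0 <= h ->
  (forall s, 0 <= s -> s <= T -> is_derive s 1 Y (dY s)) ->
  (forall s, 0 <= s -> s <= T -> is_derive s 1 I (dI s)) ->
  (forall s, 0 <= s -> s <= T -> dY s <= I s + h) ->
  (forall s, 0 <= s -> s <= T -> dI s <= h) ->
  (forall s, 0 <= s -> s <= r -> dI s <= h - d) ->
  I 0 <= 0 -> Y T <= Y 0 + h * (1 + T) * T - d * r * (T - r).
Proof.
move=> r0 rT h0 YD ID Yle Ile Ild I0.
have I1 s : 0 <= s -> s <= T -> I s <= h * T.
  move=> s0 sT; have : I s <= I 0 + h * (s - 0).
    by apply: (@drv_le_slope I dI) => // x x0 xs; [apply: ID|apply: Ile]; lra.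
  by have := ler_wpM2l h0 sT; lra.
have I2 s : r <= s -> s <= T -> I s <= h * T - d * r.
  move=> rs sT; have : I r <= I 0 + (h - d) * (r - 0).
    by apply: (@drv_le_slope I dI) => // x x0 xs; apply: ID; lra.
  have : I s <= I r + h * (s - r).
    by apply: (@drv_le_slope I dI) => // x x0 xs; [apply: ID|apply: Ile]; lra.
  by have := ler_wpM2l h0 sT; lra.
have : Y r <= Y 0 + (h * T + h) * (r - 0).
  apply: (@drv_le_slope Y dY) => // x x0 xr; first by apply: YD; lra.
  have xT : x <= T by lra.
  by have := I1 x x0 xT; have := Yle x x0 xT; lra.
have : Y T <= Y r + (h * T - d * r + h) * (T - r).
  apply: (@drv_le_slope Y dY) => // x rx xT; first by apply: YD; lra.
  have x0 : 0 <= x by lra.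
  by have := I2 x rx xT; have := Yle x x0 xT; lra.
lra.
Qed.

(** The sign of [I t0] decides whether [Y] drops in the future or in the past;
    the second case is the first one with time reversed. *)
Lemma almost_concave_drop (Y I dY dI : R -> R) (t0 T r d h : R) :
  0 <= r -> r <= T -> 0 <= h ->
  (forall t, `|t - t0| <= T -> is_derive t 1 Y (dY t)) ->
  (forall t, `|t - t0| <= T -> is_derive t 1 I (dI t)) ->
  (forall t, `|t - t0| <= T -> `|dY t - I t| <= h) ->
  (forall t, `|t - t0| <= T -> dI t <= h) ->
  (forall t, `|t - t0| <= r -> dI t <= h - d) ->
  exists t, Y t <= Y t0 + h * (1 + T) * T - d * r * (T - r).
Proof.
move=> r0 rT h0 YD ID Yle Ile Ild.
have nD s : 0 <= s -> `|t0 + s - t0| = s.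
  by move=> s0; rewrite addrAC subrr add0r ger0_norm.
have nB s : 0 <= s -> `|t0 - s - t0| = s.
  by move=> s0; rewrite addrAC subrr add0r normrN ger0_norm.
have sh (s : R) : is_derive s 1 (fun y : R => t0 + y) 1.
  by have H := drvD (drv_cst t0 s) (drv_id s); rewrite add0r in H.
have sN (s : R) : is_derive s 1 (fun y : R => t0 - y) (- 1).
  by have H := drvB (drv_cst t0 s) (drv_id s); rewrite sub0r in H.
have [I0|I0] := leP (I t0) 0.
- exists (t0 + T).
  have := @almost_concave_forward (fun s => Y (t0 + s)) (fun s => I (t0 + s))
    (fun s => dY (t0 + s)) (fun s => dI (t0 + s)) T r d h r0 rT h0.
  rewrite addr0; apply=> // s s0 sT.
  + have H := drv_comp (YD (t0 + s) _) (sh s).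
    by rewrite mulr1 in H; apply: H; rewrite nD.
  + have H := drv_comp (ID (t0 + s) _) (sh s).
    by rewrite mulr1 in H; apply: H; rewrite nD.
  + by have := Yle (t0 + s); rewrite nD// => /(_ sT); rewrite ler_norml; lra.
  + by apply: Ile; rewrite nD.
  + by apply: Ild; rewrite nD.
- exists (t0 - T).
  have := @almost_concave_forward (fun s => Y (t0 - s)) (fun s => - I (t0 - s))
    (fun s => - dY (t0 - s)) (fun s => dI (t0 - s)) T r d h r0 rT h0.
  rewrite subr0; apply=> //; last by lra.
  all: move=> s s0 sT.
  + have H := @drv_comp R _ (fun y => t0 - y) s _ _ (YD (t0 - s) _) (sN s).
    by rewrite mulrN1 in H; apply: H; rewrite nB.
  + have H := drvN (@drv_comp R _ (fun y => t0 - y) s _ _ (ID (t0 - s) _) (sN s)).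
    by rewrite mulrN1 opprK in H; apply: H; rewrite nB.
  + by have := Yle (t0 - s); rewrite nB// => /(_ sT); rewrite ler_norml; lra.
  + by apply: Ile; rewrite nB.
  + by apply: Ild; rewrite nB.
Qed.

End AlmostConcave.

(** * Logarithmic integrals *)

Section LogIntegral.
Context {R : realType}.

Let L (y s : R) := ln (s ^+ 2 + y ^+ 2).
Let G (y s : R) := s * L y s - 2 * s + 2 * y * atan (s / y).

Let arg_gt0 (y s : R) : 0 < y -> 0 < s ^+ 2 + y ^+ 2.
Proof. by move=> y0; rewrite ltr_wpDl ?sqr_ge0// exprn_gt0. Qed.

Let drvL0 (y s : R) : is_derive s 1 (fun s => s ^+ 2 + y ^+ 2) (2 * s).
Proof.
have H := drvD (drvX 2 (drv_id s)) (drv_cst (y ^+ 2) s).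
by apply: (drv_eq H); rewrite /=; ring.
Qed.

Let drvG (y s : R) : 0 < y -> is_derive s 1 (G y) (L y s).
Proof.
move=> y0; have a0 := arg_gt0 s y0.
have H1 := drvM (drv_id s) (@drv_ln R (fun s => s ^+ 2 + y ^+ 2) s _ a0 (drvL0 y s)).
have H2 := drv_div (lt0r_neq0 y0) (drv_id s) (drv_cst y s).
have H3 := @drv_comp R (@atan R) (fun s => s / y) s _ _ (is_derive1_atan _) H2.
have H := drvD (drvB H1 (drvZ 2 (drv_id s))) (drvZ (2 * y) H3).
apply: (drv_eq H); rewrite /L.
by field; rewrite addrC !lt0r_neq0.
Qed.

Let GN (y s : R) : G y (- s) = - G y s.
Proof. by rewrite /G /L sqrrN !mulNr atanN; ring. Qed.

Let cL (y : R) : 0 < y -> continuous (L y).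
Proof.
move=> y0; apply: cts_ln; last by move=> x; exact: arg_gt0.
apply: ctsD; last exact: cts_cst.
by apply: ctsX => x; exact: cvg_id.
Qed.

Let G_sum_ge (y N x : R) : 0 < y -> 0 < N -> 0 <= x ->
  2 * G y N <= G y (N + x) + G y (N - x).
Proof.
move=> y0 N0 x0.
have sh (s : R) : is_derive s 1 (fun z : R => N + z) 1.
  by have H := drvD (drv_cst N s) (drv_id s); rewrite add0r in H.
have sN (s : R) : is_derive s 1 (fun z : R => N - z) (- 1).
  by have H := drvB (drv_cst N s) (drv_id s); rewrite sub0r in H.
have D (s : R) : is_derive s 1 (fun z => G y (N + z) + G y (N - z))
    (L y (N + s) * 1 + L y (N - s) * (- 1)).
  apply: (drvD (@drv_comp R (G y) (fun z => N + z) s _ _ (drvG (N + s) y0) (sh s))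
   (@drv_comp R (G y) (fun z => N - z) s _ _ (drvG (N - s) y0) (sN s))).
have := drv_ge0_le x0 (fun s _ _ => D s).
rewrite addr0 subr0 mulr_natl mulr2n; apply => s s0 _.
rewrite mulr1 mulrN1 subr_ge0 ler_ln ?posrE ?arg_gt0// lerD2r.
by rewrite !sqrrD sqrrN; have := mulr_ge0 (ltW N0) s0; lra.
Qed.

(** The function [G y] is the odd antiderivative of [L y : s |-> ln (s ^+ 2 +
    y ^+ 2)]. The integral equals [G y (N + x) + G y (N - x)], which is
    smallest at [x = 0] because [L y] is even and increasing in the absolute
    value of its argument. *)
Lemma integ_log_ge (x y N : R) : y != 0 -> 0 < N ->
  4 * (N * ln N - N) <= integ (- N) N (fun p => ln ((p - x) ^+ 2 + y ^+ 2)).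
Proof.
move=> yn0 N0; wlog y0 : y yn0 / 0 < y.
  move=> W; have /orP[yp|yn] : (0 < y) || (y < 0) by rewrite orbC -neq_lt.
    exact: W yn0 yp.
  by rewrite -sqrrN; apply: W; rewrite ?oppr_eq0 ?oppr_gt0.
have sx (s : R) : is_derive s 1 (fun z : R => z - x) 1.
  by have H := drvB (drv_id s) (drv_cst x s); rewrite subr0 in H.
have D (s : R) : is_derive s 1 (fun z => G y (z - x)) (L y (s - x)).
  have H := @drv_comp R (G y) (fun z => z - x) s _ _ (drvG (s - x) y0) (sx s).
  by rewrite mulr1 in H.
have NN : - N <= N by lra.
have cLx : continuous (fun p => L y (p - x)).
  move=> s; apply: (@continuous_comp _ _ _ (fun z => z - x) (L y)).
    by apply: cvgB; [exact: cvg_id|exact: cvg_cst].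
  exact: cL.
rewrite (integ_derive NN cLx D).
have -> : - N - x = - (N + x) by ring.
rewrite GN opprK [leRHS]addrC.
have {D sx cLx} : 2 * G y N <= G y (N + x) + G y (N - x).
  have [x0|x0] := leP 0 x; first exact: G_sum_ge.
  have := @G_sum_ge y N (- x) y0 N0; rewrite opprK addrC; apply; lra.
move=> Gle; apply: le_trans Gle.
have A : 0 <= atan (N / y).
  by rewrite -(@atan0 R) le_atan// divr_ge0// ltW.
have := mulr_ge0 (ltW y0) A.
have : N * (2 * ln N) <= N * L y N.
  rewrite ler_wpM2l ?(ltW N0)//.
  rewrite /L mulr_natl -lnXn// ler_ln ?posrE ?arg_gt0 ?exprn_gt0//.
  by rewrite lerDl sqr_ge0.
by rewrite /G; lra.
Qed.

End LogIntegral.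

(** * Logarithmic integrals of positive polynomials *)

Section LogPolynomial.
Context {R : realType}.

(** Multiply the factorization of [p] over the complex numbers by its complex
    conjugate: a root [a + i b] contributes [(x - a) ^+ 2 + b ^+ 2]. *)
Lemma sqr_poly_no_root (p : {poly R}) : p \is monic -> (forall x, ~~ root p x) ->
  exists s : seq (R * R), [/\ size s = (size p).-1,
    forall z, z \in s -> z.2 != 0 &
    forall x, p.[x] ^+ 2 = \prod_(z <- s) ((x - z.1) ^+ 2 + z.2 ^+ 2)].
Proof.
move=> pm pr; pose pC := map_poly (real_complex R) p.
have [r rE] := closed_field_poly_normal pC.
have pCm : lead_coef pC = 1 by rewrite lead_coef_map (monicP pm) rmorph1.
rewrite pCm scale1r in rE.
exists [seq (complex.Re z, complex.Im z) | z <- r]; split.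
- by rewrite size_map -(size_map_poly (real_complex R) p) -/pC rE size_prod_XsubC.
- move=> z /mapP[w wr ->] /=; apply/eqP => w0.
  have : root pC w by rewrite rE root_prod_XsubC.
  case: w w0 {wr} => a b /= ->.
  by rewrite -[(a +i* 0)%C]/(real_complex R a) fmorph_root; apply/negP.
- move=> x; apply: (@complexI R).
  have E : (p.[x])%:C%C = \prod_(z <- r) (x%:C%C - z).
    rewrite -[LHS](horner_map (real_complex R)) -/pC rE horner_prod.
    by apply: eq_bigr => z _; rewrite hornerXsubC.
  have E' : (p.[x])%:C%C = \prod_(z <- r) conjc (x%:C%C - z).
    by rewrite -rmorph_prod/= -E /= oppr0.
  rewrite expr2 rmorphM/= {1}E E' -big_split/= big_map rmorph_prod/=.
  apply: eq_bigr => -[a b] _ /=; simpc; congr (_ +i* _)%C; ring.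
Qed.

Let q (z : R * R) (x : R) := (x - z.1) ^+ 2 + z.2 ^+ 2.

Let q_gt0 z x : z.2 != 0 -> 0 < q z x.
Proof. by move=> z0; rewrite ltr_wpDl ?sqr_ge0// exprn_even_gt0. Qed.

Let q_cts z : continuous (q z).
Proof.
apply: ctsD; last exact: cts_cst.
by apply: ctsX; apply: ctsB; [move=> x; exact: cvg_id|exact: cts_cst].
Qed.

Let integ_ln_prod_ge (s : seq (R * R)) (N : R) : 0 < N ->
  (forall z, z \in s -> z.2 != 0) ->
  4 * (size s)%:R * (N * ln N - N) <=
    integ (- N) N (fun x => ln (\prod_(z <- s) q z x)).
Proof.
move=> N0; have NN : - N <= N by lra.
elim: s => [|z s IH] sz.
  rewrite (@eq_integ R _ _ _ (fun=> 0)); last by move=> x; rewrite big_nil ln1.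
  by rewrite (integ_cst 0 NN) mul0r mulr0 mul0r.
have z0 : z.2 != 0 by apply: sz; rewrite mem_head.
have {}sz w : w \in s -> w.2 != 0 by move=> ws; apply: sz; rewrite in_cons ws orbT.
have P x : 0 < \prod_(w <- s) q w x.
  by rewrite big_seq_cond prodr_gt0// => w /andP[/sz w0 _]; exact: q_gt0.
have cP : continuous (fun x => \prod_(w <- s) q w x).
  elim: (s) => [|w s' c].
    rewrite (_ : (fun x => _) = fun=> 1); first exact: cts_cst.
    by apply/funext => x; rewrite big_nil.
  rewrite (_ : (fun x => _) = fun x => q w x * \prod_(w <- s') q w x).
    by apply: ctsM => //; exact: q_cts.
  by apply/funext => x; rewrite big_cons.
rewrite (@eq_integ R _ _ _
    (fun x => ln (q z x) + ln (\prod_(w <- s) q w x))); last first.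
  by move=> x; rewrite big_cons lnM// posrE; [exact: q_gt0|exact: P].
rewrite integD; first last.
- exact: cts_ln.
- by apply: cts_ln; [exact: q_cts|move=> x; exact: q_gt0].
have := lerD (integ_log_ge z.1 z0 N0) (IH sz).
by apply: le_trans; rewrite /= -natr1; lra.
Qed.

(** The product over [s] is the square of the polynomial, whence the factor
    2 instead of 4. *)
Lemma integ_ln_poly_ge (p : {poly R}) (N : R) : p \is monic ->
  (forall x, 0 < p.[x]) -> 0 < N ->
  2 * (size p).-1%:R * (N * ln N - N) <= integ (- N) N (fun x => ln p.[x]).
Proof.
move=> pm p0 N0.
have pr x : ~~ root p x by rewrite /root gt_eqF.
have [s [<- sz sE]] := sqr_poly_no_root pm pr.
have H := integ_ln_prod_ge N0 sz.
have cp : continuous (fun x => ln p.[x]).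
  by apply: cts_ln => //; exact: continuous_horner.
rewrite (@eq_integ R _ _ _ (fun x => 2 * ln p.[x])) in H.
  by rewrite integZ// in H; lra.
by move=> x; rewrite -sE lnXn// mulr_natl.
Qed.

End LogPolynomial.

(** * The first integral as a polynomial in the momentum *)

Section Symbol.
Context {R : realType}.
Implicit Types (n : nat) (v w : nat -> R) (x p : R).

(** The polynomial with coefficients [v 0, ..., v n] in decreasing order. With
    [v k = u_k] it is [F] without its leading term ['X^(n.+1) / n.+1], and
    with [v k = (u_k)_q] or [(u_k)_t] it is the corresponding partial
    derivative of [F]. *)
Definition Fpoly n v : {poly R} := \sum_(k < n.+1) v k *: 'X^(n - k).

(** The derivative of [F] with respect to the momentum. *)
Definition symbol n v : {poly R} := 'X^n + (Fpoly n v)^`().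

Lemma horner_Fpoly n v x :
  (Fpoly n v).[x] = \sum_(k < n.+1) v k * x ^+ (n - k).
Proof. by rewrite horner_sum; apply: eq_bigr => k _; rewrite hornerZ hornerXn. Qed.

Lemma horner_deriv_Fpoly n v x : (Fpoly n v)^`().[x] =
  \sum_(k < n.+1) v k * ((n - k)%:R * x ^+ (n - k).-1).
Proof.
rewrite /Fpoly raddf_sum horner_sum; apply: eq_bigr => k _ /=.
by rewrite derivZ derivXn hornerZ hornerMn hornerXn mulr_natl.
Qed.

Lemma size_deriv_Fpoly n v : (size (Fpoly n v)^`() <= n)%N.
Proof.
apply/leq_sizeP => j nj; rewrite coef_deriv nth_default ?mul0rn//.
apply: (@leq_trans n.+1); last by rewrite ltnS.
apply: (leq_trans (size_sum _ _ _)); apply/bigmax_leqP => k _.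
by apply: (leq_trans (size_scale_leq _ _)); rewrite size_polyXn ltnS leq_subr.
Qed.

Lemma symbol_monic n v : symbol n v \is monic.
Proof.
rewrite monicE lead_coefDl ?lead_coefXn// size_polyXn ltnS.
exact: size_deriv_Fpoly.
Qed.

Lemma size_symbol n v : size (symbol n v) = n.+1.
Proof.
by rewrite size_polyDl size_polyXn// ltnS size_deriv_Fpoly.
Qed.

(** The equation [F_t = - p F_q + (u_1)_q F_p], equivalent to the system. *)
Lemma Fpoly_pde n (ut uq u : nat -> R) (x : R) : ut 0%N = 0 -> uq 0%N = 0 ->
  uq n.+1 = 0 ->
  (forall k, (1 <= k <= n)%N ->
    ut k = (n - k + 1)%:R * u k.-1 * uq 1%N - uq k.+1) ->
  (Fpoly n ut).[x] = - (x * (Fpoly n uq).[x]) + uq 1%N * (symbol n u).[x].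
Proof.
move=> ut0 uq0 uqS pde.
rewrite /symbol hornerD hornerXn horner_deriv_Fpoly !horner_Fpoly.
rewrite big_ord_recl [in - (_ * _)]big_ord_recl
  [X in uq 1%N * (_ + X)]big_ord_recr /=.
rewrite ut0 uq0 !mul0r !add0r subnn mul0r mulr0 addr0.
have -> : x * (\sum_(i < n) uq (bump 0 i) * x ^+ (n - bump 0 i)) =
    \sum_(i < n) uq i.+1 * x ^+ (n - i).
  rewrite mulr_sumr; apply: eq_bigr => i _ /=.
  by rewrite /bump /= add1n mulrCA -exprS subnSK.
have -> : \sum_(i < n) uq i.+1 * x ^+ (n - i) =
    uq 1%N * x ^+ n + \sum_(i < n) uq i.+2 * x ^+ (n - i.+1).
  have := big_ord_recl n (fun i : 'I_n.+1 => uq i.+1 * x ^+ (n - i))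
    (op := +%R) (idx := 0).
  rewrite big_ord_recr /= uqS mul0r addr0 subn0 => ->.
  by congr (_ + _); apply: eq_bigr.
rewrite mulrDr mulr_sumr.
have -> : \sum_(i < n) ut (bump 0 i) * x ^+ (n - bump 0 i) =
    \sum_(i < n) uq 1%N * (u i * ((n - i)%:R * x ^+ (n - i).-1)) -
    \sum_(i < n) uq i.+2 * x ^+ (n - i.+1).
  rewrite -sumrB; apply: eq_bigr => i _.
  rewrite /bump /= add1n pde ?ltn_ord//= addn1 subnSK// -subnS; ring.
ring.
Qed.

(** The derivative of [Fpoly_pde] with respect to the momentum. *)
Lemma deriv_Fpoly_pde n (ut uq u : nat -> R) (x : R) : ut 0%N = 0 -> uq 0%N = 0 ->
  uq n.+1 = 0 ->
  (forall k, (1 <= k <= n)%N ->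
    ut k = (n - k + 1)%:R * u k.-1 * uq 1%N - uq k.+1) ->
  (Fpoly n ut)^`().[x] = - (Fpoly n uq).[x] - x * (Fpoly n uq)^`().[x] +
    uq 1%N * (symbol n u)^`().[x].
Proof.
move=> ut0 uq0 uqS pde.
apply: (@drv_unique _ (fun y => (Fpoly n ut).[y]) x).
  exact: is_derive_poly.
rewrite (_ : (fun y => _) =
  fun y => - (y * (Fpoly n uq).[y]) + uq 1%N * (symbol n u).[y]); last first.
  by apply/funext => y; exact: Fpoly_pde.
have H := drvD (drvN (drvM (drv_id x) (is_derive_poly (Fpoly n uq) x)))
  (drvZ (uq 1%N) (is_derive_poly (symbol n u) x)).
by apply: (drv_eq H); ring.
Qed.

End Symbol.

(** * Bounds on the symbol at large momentum *)

Section SymbolBounds.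
Context {R : realType}.
Variables (n : nat) (v w : nat -> R) (B : R).
Hypothesis n_gt1 : (1 < n)%N.
Hypothesis n_even : ~~ odd n.
Hypothesis vB : forall k, (k <= n)%N -> `|v k| <= B.
Hypothesis wB : forall k, (k <= n)%N -> `|w k| <= B.
Hypothesis w0 : w 0%N = 0.

(** In the application [v k = u_k] and [w k = (u_k)_q] at some point (q, t).
    The symbol is the sum of [x ^+ n] and [r x], and [`|r x|] is at most
    [C * `|x| ^+ n.-1] when [1 <= `|x|]. *)
Let r x : R := (Fpoly n v)^`().[x].
Let C : R := n.+1%:R * (n%:R * B).

Let B_ge0 : 0 <= B.
Proof. exact: le_trans (vB (leq0n n)). Qed.

Let C_ge0 : 0 <= C.
Proof. by rewrite !mulr_ge0. Qed.

Let norm_sum_le (m : nat) (f : 'I_m -> R) (c : R) : (forall k, `|f k| <= c) ->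
  `|\sum_(k < m) f k| <= m%:R * c.
Proof.
move=> fc; apply: (le_trans (ler_norm_sum _ _ _)).
apply: (@le_trans _ _ (\sum_(k < m) c)); first exact: ler_sum.
by rewrite sumr_const card_ord mulr_natl.
Qed.

Let pow_gt0 (N : R) m : 1 <= N -> 0 < N ^+ m.
Proof. by move=> N1; rewrite exprn_gt0// (lt_le_trans ltr01). Qed.

Let powE1 (N : R) : 1 <= N -> N ^+ n.-1 = N ^+ n / N.
Proof.
move=> N1; have N0 : N != 0 by rewrite gt_eqF// (lt_le_trans ltr01).
by rewrite -[in RHS](prednK (ltnW n_gt1)) exprS mulrC mulKf.
Qed.

Let powE2 (N : R) : 1 <= N -> N ^+ (n - 2) = N ^+ n / N ^+ 2.
Proof.
move=> N1; have N0 : N != 0 by rewrite gt_eqF// (lt_le_trans ltr01).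
by rewrite -[in RHS](subnK n_gt1) exprD mulfK// expf_neq0.
Qed.

Let ler_mul_norm (a b c d : R) : `|a| <= c -> `|b| <= d -> `|a * b| <= c * d.
Proof. by move=> ac bd; rewrite normrM ler_pM. Qed.

Let r_le (x : R) : 1 <= `|x| -> `|r x| <= C * `|x| ^+ n.-1.
Proof.
move=> x1; rewrite /r horner_deriv_Fpoly /C -mulrA.
apply: norm_sum_le => k; rewrite [n%:R * B]mulrC -mulrA.
have kn : (k <= n)%N by rewrite -ltnS.
apply: ler_mul_norm; first exact: vB.
rewrite normrM normrX ger0_norm// ler_pM// ?exprn_ge0 ?ler_nat ?leq_subr//.
by rewrite ler_weXn2l// -!subn1 leq_sub2r// leq_subr.
Qed.

Let r_sum_le (N : R) : 1 <= N -> `|r N + r (- N)| <= 2 * C * N ^+ (n - 2).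
Proof.
move=> N1; have N0 : 0 <= N by rewrite (le_trans ler01).
rewrite /r !horner_deriv_Fpoly -big_split/=.
have -> : 2 * C * N ^+ (n - 2) =
    n.+1%:R * (B * (n%:R * (2 * N ^+ (n - 2)))) by rewrite /C; ring.
apply: norm_sum_le => k; rewrite -mulrDr.
have kn : (k <= n)%N by rewrite -ltnS.
apply: ler_mul_norm; first exact: vB.
rewrite -mulrDr; apply: ler_mul_norm.
  by rewrite ger0_norm// ler_nat leq_subr.
have [k0|k0] := posnP k.
  (* The leading terms cancel because n - 1 is odd. *)
  rewrite k0 subn0 [(- N) ^+ _]exprNn -signr_odd.
  have -> : odd n.-1 by move: n_even; case: (n) n_gt1 => //= m _; rewrite negbK.
  by rewrite expr1 mulN1r subrr normr0 mulr_ge0// exprn_ge0.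
apply: (le_trans (ler_normD _ _)).
rewrite !normrX normrN ger0_norm// -mulr2n mulr_natl lerMn2r/=.
rewrite ler_weXn2l//; move: k0 kn; lia.
Qed.

Let w_le (x : R) : 1 <= `|x| ->
  `|(Fpoly n w).[x]| <= n.+1%:R * B * `|x| ^+ n.-1.
Proof.
move=> x1; rewrite horner_Fpoly -mulrA; apply: norm_sum_le => k.
have kn : (k <= n)%N by rewrite -ltnS.
have [->|k0] := posnP k.
  by rewrite w0 mul0r normr0 mulr_ge0// exprn_ge0.
apply: ler_mul_norm; first exact: wB.
by rewrite normrX ler_weXn2l//; move: k0 kn; lia.
Qed.

Let symbolE x : (symbol n v).[x] = x ^+ n + r x.
Proof. by rewrite hornerD hornerXn. Qed.

Let powN (N : R) : (- N) ^+ n = N ^+ n.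
Proof. by rewrite exprNn -signr_odd (negbTE n_even) mul1r. Qed.

Let r_leE (N x : R) : 1 <= N -> `|x| = N -> `|r x| <= C / N * N ^+ n.
Proof.
by move=> N1 xN; have := @r_le x; rewrite xN powE1// => /(_ N1); rewrite mulrCA mulrC.
Qed.

Lemma symbol_ge (N x : R) : 1 <= N -> 2 * C <= N -> `|x| = N ->
  N ^+ n / 2 <= (symbol n v).[x].
Proof.
move=> N1 NC xN; have N0 : 0 < N by rewrite (lt_le_trans ltr01).
have xn : x ^+ n = N ^+ n.
  by rewrite -xN; case: (ger0P x); rewrite ?powN.
have M0 : 0 < N ^+ n by exact: pow_gt0.
have : C / N * N ^+ n <= 1 / 2 * N ^+ n.
  by rewrite ler_pM2r// ler_pdivrMr//; lra.
by have := r_leE N1 xN; rewrite symbolE xn ler_norml; lra.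
Qed.

Lemma ln_symbol_diff (N : R) : 1 <= N -> 2 * C <= N ->
  `|ln (symbol n v).[N] - ln (symbol n v).[- N]| <= 4 * C / N.
Proof.
move=> N1 NC; have N0 : 0 < N by rewrite (lt_le_trans ltr01).
have nN : `|N| = N by rewrite gtr0_norm.
have nNN : `|- N| = N by rewrite normrN.
have M0 : 0 < N ^+ n by exact: pow_gt0.
have D : `|(symbol n v).[N] - (symbol n v).[- N]| <= 4 * C / N * (N ^+ n / 2).
  rewrite !symbolE powN opprD addrACA subrr add0r.
  apply: (le_trans (ler_normB _ _)).
  by have := r_leE N1 nN; have := r_leE N1 nNN; lra.
have half (a b : R) : N ^+ n / 2 <= a -> N ^+ n / 2 <= b ->
    `|a - b| <= 4 * C / N * (N ^+ n / 2) -> ln a - ln b <= 4 * C / N.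
  move=> aM bM ab; have a0 : 0 < a by lra.
  have b0 : 0 < b by lra.
  rewrite -ln_div ?posrE//.
  have -> : a / b = 1 + (a - b) / b by field; rewrite gt_eqF.
  apply: (@le_trans _ _ ((a - b) / b)).
    by apply: le_ln1Dx; rewrite mulrBl divff ?gt_eqF//; have := divr_gt0 a0 b0; lra.
  rewrite ler_pdivrMr//; apply: (le_trans (ler_norm _)); apply: (le_trans ab).
  by rewrite ler_wpM2l// divr_ge0 ?(ltW N0)// mulr_ge0.
have P1 := symbol_ge N1 NC nN; have P2 := symbol_ge N1 NC nNN.
by rewrite ler_norml lerNl opprB !half// distrC.
Qed.

Lemma ratio_symbol_le (N x : R) : 1 <= N -> 2 * C <= N -> `|x| = N ->
  `|(Fpoly n w).[x] / (symbol n v).[x]| <= 2 * n.+1%:R * B / N.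
Proof.
move=> N1 NC xN; have N0 : 0 < N by rewrite (lt_le_trans ltr01).
have M0 : 0 < N ^+ n by exact: pow_gt0.
have P1 := symbol_ge N1 NC xN.
have P0 : 0 < (symbol n v).[x] by apply: lt_le_trans P1; rewrite divr_gt0.
rewrite normrM normfV (gtr0_norm P0) ler_pdivrMr//.
have W := @w_le x; rewrite xN in W; apply: (le_trans (W N1)).
have -> : n.+1%:R * B * N ^+ n.-1 = 2 * n.+1%:R * B / N * (N ^+ n / 2).
  by rewrite powE1//; field; rewrite gt_eqF.
by rewrite ler_wpM2l// divr_ge0 ?(ltW N0)// !mulr_ge0.
Qed.

(** The terms of order [1 / N] cancel since [n] is even. *)
Lemma ln_symbol_sum (N : R) : 1 <= N -> 0 < (symbol n v).[N] ->
  0 < (symbol n v).[- N] ->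
  ln (symbol n v).[N] + ln (symbol n v).[- N] - 2 * n%:R * ln N <=
    (2 * C + C ^+ 2) / N ^+ 2.
Proof.
move=> N1 a0 b0; have N0 : 0 < N by rewrite (lt_le_trans ltr01).
have M0 : 0 < N ^+ n by exact: pow_gt0.
have nN : `|N| = N by rewrite gtr0_norm.
have nNN : `|- N| = N by rewrite normrN.
set a := (symbol n v).[N] in a0 *; set b := (symbol n v).[- N] in b0 *.
have -> : ln a + ln b - 2 * n%:R * ln N = ln (a * b / (N ^+ n) ^+ 2).
  rewrite ln_div ?posrE ?mulr_gt0 ?exprn_gt0// lnM ?posrE//.
  by rewrite !lnXn// -(mulr_natl (ln N) n); ring.
have ab0 : 0 < a * b / (N ^+ n) ^+ 2 by rewrite divr_gt0 ?mulr_gt0 ?exprn_gt0.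
apply: (@le_trans _ _ (a * b / (N ^+ n) ^+ 2 - 1)).
  rewrite -[X in ln X](subrK 1) addrC; apply: le_ln1Dx.
  by move: ab0; set c := _ / _; lra.
rewrite lerBlDr ler_pdivrMr ?exprn_gt0//.
rewrite /a /b !symbolE powN.
have S := r_sum_le N1; rewrite powE2// in S.
have Pr : r N * r (- N) <= (C / N * N ^+ n) * (C / N * N ^+ n).
  apply: (le_trans (ler_norm _)); apply: ler_mul_norm; exact: r_leE.
have S' : N ^+ n * (r N + r (- N)) <= N ^+ n * (2 * C * (N ^+ n / N ^+ 2)).
  by rewrite ler_pM2l//; apply: le_trans S; exact: ler_norm.
have -> : (N ^+ n + r N) * (N ^+ n + r (- N)) =
  (N ^+ n) ^+ 2 + N ^+ n * (r N + r (- N)) + r N * r (- N) by ring.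
have -> : ((2 * C + C ^+ 2) / N ^+ 2 + 1) * (N ^+ n) ^+ 2 =
  (N ^+ n) ^+ 2 + N ^+ n * (2 * C * (N ^+ n / N ^+ 2)) +
  (C / N * N ^+ n) * (C / N * N ^+ n) by field; rewrite gt_eqF.
by rewrite !lerD.
Qed.

End SymbolBounds.

(** * Functions of position, momentum and time *)

Section ThreeVariables.
Context {R : realType}.
Implicit Types f g : R -> R -> R -> R.

(** Joint continuity of a function of position, momentum and time, in this
    order. *)
Definition cts3 f := continuous (fun x : R * (R * R) => f x.1 x.2.1 x.2.2).

Lemma cts_fst (S T : topologicalType) : continuous (@fst S T).
Proof. by move=> x; exact: cvg_fst. Qed.

Lemma cts_snd (S T : topologicalType) : continuous (@snd S T).
Proof. by move=> x; exact: cvg_snd. Qed.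

Lemma cts_comp (S T U : topologicalType) (f : S -> T) (g : T -> U) :
  continuous f -> continuous g -> continuous (fun x => g (f x)).
Proof. by move=> cf cg x; apply: continuous_comp; [exact: cf|exact: cg]. Qed.

Lemma cts_pair (S T U : topologicalType) (f : S -> T) (g : S -> U) :
  continuous f -> continuous g -> continuous (fun x => (f x, g x)).
Proof. by move=> cf cg x; apply: cvg_pair; [exact: cf|exact: cg]. Qed.

Lemma cts3_q f (p t : R) : cts3 f -> continuous (fun q => f q p t).
Proof.
by move=> cf; exact: (@continuous_section R _ (fun q z => f q z.1 z.2) (p, t)).
Qed.

Lemma cts3_qt f (p : R) : cts3 f -> continuous (fun x : R * R => f x.1 p x.2).
Proof.
move=> cf; apply: (@cts_comp _ _ _ (fun x : R * R => (x.1, (p, x.2))) _ _ cf).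
apply: cts_pair; first exact: cts_fst.
by apply: cts_pair; [move=> x; exact: cvg_cst|exact: cts_snd].
Qed.

Lemma cts3_qp f (t : R) : cts3 f -> continuous (fun x : R * R => f x.1 x.2 t).
Proof.
move=> cf; apply: (@cts_comp _ _ _ (fun x : R * R => (x.1, (x.2, t))) _ _ cf).
apply: cts_pair; first exact: cts_fst.
by apply: cts_pair; [exact: cts_snd|move=> x; exact: cvg_cst].
Qed.

Lemma cts3_pt (f : R -> R -> R) :
  continuous (fun x : R * R => f x.1 x.2) -> cts3 (fun q _ t => f q t).
Proof.
move=> cf; apply: (@cts_comp _ _ _ (fun x : R * (R * R) => (x.1, x.2.2)) _ _ cf).
apply: cts_pair; first exact: cts_fst.
by apply: (@cts_comp _ _ _ snd snd); exact: cts_snd.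
Qed.

Lemma cts3_p : cts3 (fun _ p _ => p).
Proof. by apply: (@cts_comp _ _ _ snd fst); [exact: cts_snd|exact: cts_fst]. Qed.

Lemma cts3_integ f (a b : R) : a <= b -> cts3 f ->
  continuous (fun z : R * R => integ a b (fun q => f q z.1 z.2)).
Proof.
by move=> ab cf; exact: (@continuous_integ R _ (fun q z => f q z.1 z.2) a b ab cf).
Qed.

Lemma rectangle_bounded (f : R -> R -> R) (a b c d : R) : a <= b -> c <= d ->
  continuous (fun x : R * R => f x.1 x.2) ->
  exists B, forall q t, a <= q <= b -> c <= t <= d -> f q t <= B.
Proof.
move=> ab cd cf.
have K : compact (`[a, b]%classic `*` `[c, d]%classic : set (R * R)).
  by apply: compact_setX; exact: segment_compact.
have [||x _ xM] := @compact_EVT_max _ R (fun x : R * R => f x.1 x.2) _ _ K.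
- by exists (a, c); split; rewrite /= in_itv/= lexx.
- exact: continuous_subspaceT.
exists (f x.1 x.2) => q t qI tI; apply: (xM (q, t)).
by rewrite inE; split => /=; rewrite in_itv.
Qed.

End ThreeVariables.
Arguments cts3_q {R f} p t _.
Arguments cts3_qt {R f} p _.
Arguments cts3_qp {R f} t _.

Section SymbolCalculus.
Context {R : realType}.
Variable n : nat.

Lemma drv_Fpoly (v : nat -> R -> R) (dv : nat -> R) (p s : R) :
  (forall k, is_derive s 1 (v k) (dv k)) ->
  is_derive s 1 (fun s => (Fpoly n (v^~ s)).[p]) (Fpoly n dv).[p].
Proof.
move=> vd; rewrite horner_Fpoly.
rewrite (_ : (fun s => _) =
  fun s => \sum_(k < n.+1) v k s * p ^+ (n - k)); last first.
  by apply/funext => s'; rewrite horner_Fpoly.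
apply: (@drv_sum R _ (fun k s => v k s * p ^+ (n - k))) => k.
have H := drvM (vd k) (drv_cst (p ^+ (n - k)) s).
by apply: (drv_eq H); rewrite mulr0 addr0.
Qed.

Lemma drv_deriv_Fpoly (v : nat -> R -> R) (dv : nat -> R) (p s : R) :
  (forall k, is_derive s 1 (v k) (dv k)) ->
  is_derive s 1 (fun s => (Fpoly n (v^~ s))^`().[p]) (Fpoly n dv)^`().[p].
Proof.
move=> vd; rewrite horner_deriv_Fpoly.
rewrite (_ : (fun s => _) =
  fun s => \sum_(k < n.+1) v k s * ((n - k)%:R * p ^+ (n - k).-1)); last first.
  by apply/funext => s'; rewrite horner_deriv_Fpoly.
apply: (@drv_sum R _ (fun k s => v k s * ((n - k)%:R * p ^+ (n - k).-1))) => k.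
have H := drvM (vd k) (drv_cst ((n - k)%:R * p ^+ (n - k).-1) s).
by apply: (drv_eq H); rewrite mulr0 addr0.
Qed.

Lemma drv_symbol (v : nat -> R -> R) (dv : nat -> R) (p s : R) :
  (forall k, is_derive s 1 (v k) (dv k)) ->
  is_derive s 1 (fun s => (symbol n (v^~ s)).[p]) (Fpoly n dv)^`().[p].
Proof.
move=> vd; rewrite (_ : (fun s => _) =
    fun s => p ^+ n + (Fpoly n (v^~ s))^`().[p]); last first.
  by apply/funext => s'; rewrite hornerD hornerXn.
have H := drvD (drv_cst (p ^+ n) s) (drv_deriv_Fpoly p vd).
by rewrite add0r in H.
Qed.

Lemma cts_Fpoly (T : topologicalType) (v : nat -> T -> R) (f : T -> R) :
  (forall k, continuous (v k)) -> continuous f ->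
  continuous (fun x => (Fpoly n (v^~ x)).[f x]).
Proof.
move=> cv cf; rewrite (_ : (fun x => _) =
  fun x => \sum_(k < n.+1) v k x * f x ^+ (n - k)); last first.
  by apply/funext => x; rewrite horner_Fpoly.
by apply: cts_sum => k; apply: ctsM => //; exact: ctsX.
Qed.

Lemma cts_deriv_Fpoly (T : topologicalType) (v : nat -> T -> R) (f : T -> R) :
  (forall k, continuous (v k)) -> continuous f ->
  continuous (fun x => (Fpoly n (v^~ x))^`().[f x]).
Proof.
move=> cv cf; rewrite (_ : (fun x => _) =
  fun x => \sum_(k < n.+1) v k x * ((n - k)%:R * f x ^+ (n - k).-1)); last first.
  by apply/funext => x; rewrite horner_deriv_Fpoly.
apply: cts_sum => k; apply: ctsM => //; apply: ctsM; first exact: cts_cst.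
exact: ctsX.
Qed.

Lemma cts_symbol (T : topologicalType) (v : nat -> T -> R) (f : T -> R) :
  (forall k, continuous (v k)) -> continuous f ->
  continuous (fun x => (symbol n (v^~ x)).[f x]).
Proof.
move=> cv cf; rewrite (_ : (fun x => _) =
  fun x => f x ^+ n + (Fpoly n (v^~ x))^`().[f x]); last first.
  by apply/funext => x; rewrite hornerD hornerXn.
by apply: ctsD; [exact: ctsX|exact: cts_deriv_Fpoly].
Qed.

Lemma horner_deriv_symbol (v : nat -> R) (p : R) : (symbol n v)^`().[p] =
  n%:R * p ^+ n.-1 +
  \sum_(k < n.+1) v k * ((n - k)%:R * ((n - k).-1%:R * p ^+ (n - k).-2)).
Proof.
rewrite /symbol derivD hornerD derivXn hornerMn hornerXn mulr_natl; congr (_ + _).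
rewrite /Fpoly !raddf_sum horner_sum; apply: eq_bigr => k _ /=.
by rewrite derivZ derivXn derivZ derivMn derivXn hornerZ !hornerMn hornerXn !mulr_natl.
Qed.

Lemma cts_deriv_symbol (T : topologicalType) (v : nat -> T -> R) (f : T -> R) :
  (forall k, continuous (v k)) -> continuous f ->
  continuous (fun x => (symbol n (v^~ x))^`().[f x]).
Proof.
move=> cv cf; rewrite (_ : (fun x => _) = fun x => n%:R * f x ^+ n.-1 +
  \sum_(k < n.+1) v k x * ((n - k)%:R * ((n - k).-1%:R * f x ^+ (n - k).-2)));
  last by apply/funext => x; rewrite horner_deriv_symbol.
apply: ctsD; first by apply: ctsM; [exact: cts_cst|exact: ctsX].
apply: cts_sum => k; apply: ctsM => //; do 2 (apply: ctsM; first exact: cts_cst).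
exact: ctsX.
Qed.

End SymbolCalculus.

(** * Positivity of integrals and vanishing of polynomials *)

Section Positivity.
Context {R : realType}.

Lemma continuous_ge_half (f : R -> R) (x : R) : continuous f -> 0 < f x ->
  exists2 r, 0 < r & forall y, `|y - x| <= r -> f x / 2 <= f y.
Proof.
move=> cf fx; have fx2 : 0 < f x / 2 by rewrite divr_gt0.
have /cvgrPdist_lt/(_ _ fx2)/nbhs_ballP[s /= s0 sH] := cf x.
exists (s / 2); first by rewrite divr_gt0.
move=> y ys; have : ball x s y by rewrite /ball/= distrC; lra.
by move=> /sH /=; rewrite ltr_norml; lra.
Qed.

Lemma subitv_integ_le (f : R -> R) (a b c d : R) : a <= c -> c <= d -> d <= b ->
  continuous f -> (forall x, 0 <= f x) -> integ c d f <= integ a b f.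
Proof.
move=> ac cd db cf f0; have cb := le_trans cd db.
rewrite (integ_split ac cb cf) (integ_split cd db cf) addrCA lerDl.
by rewrite addr_ge0// integ_ge0.
Qed.

Lemma integ_gt0 (f : R -> R) (a b x : R) : a <= x -> x < b ->
  continuous f -> (forall y, 0 <= f y) -> 0 < f x -> 0 < integ a b f.
Proof.
move=> ax xb cf f0 fx.
have fx2 : 0 < f x / 2 by rewrite divr_gt0.
have [r r0 rH] := continuous_ge_half cf fx.
pose s := Num.min r (b - x).
have s0 : 0 < s by rewrite lt_min r0 subr_gt0.
have sr : s <= r by rewrite ge_min lexx.
have sb : x + s <= b by rewrite -lerBrDl ge_min lexx orbT.
have xs : x <= x + s by rewrite lerDl ltW.
apply: lt_le_trans (subitv_integ_le ax xs sb cf f0).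
apply: (@lt_le_trans _ _ (f x / 2 * (x + s - x))).
  by rewrite addrAC subrr add0r mulr_gt0.
rewrite -(integ_cst _ xs); apply: le_integ => //; first exact: cts_cst.
move=> y; rewrite in_itv/= => /andP[xy ys].
by apply: rH; rewrite ger0_norm ?subr_ge0//; lra.
Qed.

(** Here [y0] and [y] are the values of an almost concave function before and
    after its drop, and [l] is its lower bound. *)
Lemma drop_contradiction (l y y0 b h z : R) : l <= y ->
  y <= y0 + h - (z + 2) -> y0 <= l + b -> h <= 1 -> b <= z -> False.
Proof. by move=> *; lra. Qed.

Lemma Fpoly_eq0 n (v : nat -> R) : (forall p, (Fpoly n v).[p] = 0) ->
  forall k, (k <= n)%N -> v k = 0.
Proof.
move=> v0 k kn; have p0 : Fpoly n v = 0.
  apply/eqP/negPn/negP => pn0.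
  (* As many roots as the size of the polynomial, hence too many. *)
  pose rs : seq R := [seq i%:R | i <- iota 0 (size (Fpoly n v))].
  have := max_poly_roots pn0 (rs := rs); rewrite size_map size_iota ltnn => H.
  suff : false by []; apply: H.
    by apply/allP => x _; rewrite /root v0.
  by rewrite map_inj_uniq ?iota_uniq// => i j /eqP; rewrite eqr_nat => /eqP.
have : (Fpoly n v)`_(n - k) = 0 by rewrite p0 coef0.
rewrite coef_sum (bigD1 (inord k))//= inordK ?ltnS// coefZ coefXn eqxx mulr1.
rewrite big1 ?addr0// => i /eqP ik; rewrite coefZ coefXn.
case: eqP => [E|_]; last by rewrite mulr0.
by case: ik; apply: val_inj; rewrite /= inordK ?ltnS//; have := ltn_ord i; lia.
Qed.

End Positivity.

(** * The slope of the level curves and its Riccati equation *)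

Section EllipticSystem.
Context {R : realType}.
Variables (n : nat) (u0 : R) (u : nat -> R -> R -> R).
Hypothesis n_gt1 : (1 < n)%N.
Hypothesis n_even : ~~ odd n.
Hypothesis u_C2 : forall k, class_C 2 (u k).
Hypothesis u_per : forall k q t, u k (q + 1) t = u k q t.
Hypothesis u_0 : forall q t, u 0%N q t = u0.
Hypothesis u_S : forall q t, u n.+1 q t = 0.
Hypothesis u_pde : forall k q t, (1 <= k <= n)%N ->
  partial_t (u k) q t =
  (n - k + 1)%:R * u k.-1 q t * partial_q (u 1%N) q t - partial_q (u k.+1) q t.

(** The symbol of the system at (q, t), evaluated at the momentum p. *)
Let P q p t := (symbol n (fun k => u k q t)).[p].
Hypothesis P_gt0 : forall q p t, 0 < P q p t.

(** The subscripts q, p, t stand for partial derivatives. In [Fq], [Fqq] and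
    [Fqt] the leading term of [F] is absent, since it is constant in q and t. *)
Let uq k := partial_q (u k).
Let uqq k := partial_q (uq k).
Let uqt k := partial_t (uq k).
Let Fq q p t := (Fpoly n (fun k => uq k q t)).[p].
Let Fqq q p t := (Fpoly n (fun k => uqq k q t)).[p].
Let Fqt q p t := (Fpoly n (fun k => uqt k q t)).[p].
Let Pq q p t := (Fpoly n (fun k => uq k q t))^`().[p].
Let Pt q p t := (Fpoly n (fun k => partial_t (u k) q t))^`().[p].
Let Pp q p t := (symbol n (fun k => u k q t))^`().[p].

(** The slope of the level curves of [F] in the (q, p) plane, followed by its
    partial derivatives. *)
Let W q p t := - (Fq q p t / P q p t).
Let Wq q p t := - (Fqq q p t / P q p t - Fq q p t * Pq q p t / P q p t ^+ 2).
Let Wt q p t := - (Fqt q p t / P q p t - Fq q p t * Pt q p t / P q p t ^+ 2).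
Let Wp q p t := - (Pq q p t / P q p t - Fq q p t * Pp q p t / P q p t ^+ 2).

Let P_neq0 q p t : P q p t != 0. Proof. by rewrite gt_eqF. Qed.

Let uq_C1 k : class_C 1 (uq k).
Proof. by have [_ [_ _ c _]] := u_C2 k; exact: c. Qed.

Let ut_C1 k : class_C 1 (partial_t (u k)).
Proof. by have [_ [_ _ _ c]] := u_C2 k; exact: c. Qed.

Let drv_u_q k (q t : R) : is_derive q 1 ((u k)^~ t) (uq k q t).
Proof. exact: class_C_drv_q (u_C2 k). Qed.

Let drv_u_t k (q t : R) : is_derive t 1 (u k q) (partial_t (u k) q t).
Proof. exact: class_C_drv_t (u_C2 k). Qed.

Let drv_uq_q k (q t : R) : is_derive q 1 ((uq k)^~ t) (uqq k q t).
Proof. exact: class_C_drv_q (uq_C1 k). Qed.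

Let drv_uq_t k (q t : R) : is_derive t 1 (uq k q) (uqt k q t).
Proof. exact: class_C_drv_t (uq_C1 k). Qed.

Let drv_ut_q k (q t : R) : is_derive q 1 ((partial_t (u k))^~ t) (uqt k q t).
Proof.
by rewrite /uqt -(Schwarz_partial q t (u_C2 k)); exact: class_C_drv_q (ut_C1 k).
Qed.

Let uq_0 q t : uq 0%N q t = 0.
Proof.
apply: drv_unique (drv_u_q 0%N q t) _.
rewrite (_ : (u 0%N)^~ t = fun=> u0); first exact: drv_cst.
by apply/funext => q'; exact: u_0.
Qed.

Let uq_S q t : uq n.+1 q t = 0.
Proof.
apply: drv_unique (drv_u_q n.+1 q t) _.
rewrite (_ : (u n.+1)^~ t = fun=> 0); first exact: drv_cst.
by apply/funext => q'; exact: u_S.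
Qed.

Let ut_0 q t : partial_t (u 0%N) q t = 0.
Proof.
apply: drv_unique (drv_u_t 0%N q t) _.
rewrite (_ : u 0%N q = fun=> u0); first exact: drv_cst.
by apply/funext => t'; exact: u_0.
Qed.

Let uq_per k q t : uq k (q + 1) t = uq k q t.
Proof.
have sh : is_derive q 1 (fun z : R => z + 1) 1.
  by have H := drvD (drv_id q) (drv_cst 1 q); rewrite addr0 in H.
have H := @drv_comp R ((u k)^~ t) (fun z => z + 1) q _ _ (drv_u_q k (q + 1) t) sh.
rewrite mulr1 in H; apply: drv_unique H _.
rewrite (_ : (fun y => _) = (u k)^~ t); first exact: drv_u_q.
by apply/funext => y; exact: u_per.
Qed.

Let PtE q p t : Pt q p t =
  - Fq q p t - p * Pq q p t + uq 1%N q t * Pp q p t.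
Proof.
apply: (@deriv_Fpoly_pde R n (fun k => partial_t (u k) q t)
  (fun k => uq k q t) (fun k => u k q t) p).
- exact: ut_0.
- exact: uq_0.
- exact: uq_S.
- by move=> k kn; exact: u_pde.
Qed.

Let drvP_q (q p t : R) : is_derive q 1 (fun q => P q p t) (Pq q p t).
Proof. exact: (@drv_symbol R n (fun k q => u k q t)). Qed.

Let drvP_t (q p t : R) : is_derive t 1 (P q p) (Pt q p t).
Proof. exact: (@drv_symbol R n (fun k t => u k q t)). Qed.

Let drvP_p (q p t : R) : is_derive p 1 (fun p => P q p t) (Pp q p t).
Proof. exact: is_derive_poly. Qed.

Let drvFq_q (q p t : R) : is_derive q 1 (fun q => Fq q p t) (Fqq q p t).
Proof. exact: (@drv_Fpoly R n (fun k q => uq k q t)). Qed.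

Let drvFq_t (q p t : R) : is_derive t 1 (Fq q p) (Fqt q p t).
Proof. exact: (@drv_Fpoly R n (fun k t => uq k q t)). Qed.

Let drvFq_p (q p t : R) : is_derive p 1 (fun p => Fq q p t) (Pq q p t).
Proof. exact: is_derive_poly. Qed.

(** The q-derivative of the equation [F_t = - p F_q + (u_1)_q F_p]. *)
Let FqtE q p t : Fqt q p t =
  - (p * Fqq q p t) + uqq 1%N q t * P q p t + uq 1%N q t * Pq q p t.
Proof.
apply: (@drv_unique _ (fun q => (Fpoly n (fun k => partial_t (u k) q t)).[p]) q).
  exact: (@drv_Fpoly R n (fun k q => partial_t (u k) q t)).
rewrite (_ : (fun q => _) =
    fun q => - (p * Fq q p t) + uq 1%N q t * P q p t); last first.
  apply/funext => q'; apply: Fpoly_pde.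
  - exact: ut_0.
  - exact: uq_0.
  - exact: uq_S.
  - by move=> k kn; exact: u_pde.
have H := drvD (drvN (drvZ p (drvFq_q q p t)))
  (drvM (drv_uq_q 1%N q t) (drvP_q q p t)).
by apply: (drv_eq H); rewrite addrA.
Qed.

Let drvW_q (q p t : R) : is_derive q 1 (fun q => W q p t) (Wq q p t).
Proof. exact: (drvN (@drv_div R (fun q => Fq q p t) (fun q => P q p t) q _ _
    (P_neq0 q p t) (drvFq_q q p t) (drvP_q q p t))). Qed.

Let drvW_t (q p t : R) : is_derive t 1 (W q p) (Wt q p t).
Proof. exact: (drvN (@drv_div R (Fq q p) (P q p) t _ _
    (P_neq0 q p t) (drvFq_t q p t) (drvP_t q p t))). Qed.

Let drvW_p (q p t : R) : is_derive p 1 (fun p => W q p t) (Wp q p t).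
Proof. exact: (drvN (@drv_div R (fun p => Fq q p t) (fun p => P q p t) p _ _
    (P_neq0 q p t) (drvFq_p q p t) (drvP_p q p t))). Qed.

(** The equation of Riccati for the slope of the level curves. *)
Let Riccati q p t : Wt q p t =
  uq 1%N q t * Wp q p t - W q p t ^+ 2 - p * Wq q p t - uqq 1%N q t.
Proof.
rewrite /Wt FqtE PtE /Wp /W /Wq.
have := P_neq0 q p t; move: (P q p t) (Fq q p t) (Fqq q p t) (Pq q p t)
  (Pp q p t) (uq 1%N q t) (uqq 1%N q t) => a b c d e f g a0.
by field.
Qed.

(** The evolution equation of the logarithm of the symbol. *)
Let lnPtE q p t : Pt q p t / P q p t =
  W q p t + uq 1%N q t * (Pp q p t / P q p t) - p * (Pq q p t / P q p t).
Proof.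
rewrite PtE /W.
have := P_neq0 q p t; move: (P q p t) (Fq q p t) (Pq q p t)
  (Pp q p t) (uq 1%N q t) => a b c d e a0.
by field.
Qed.

Let cts_u k : continuous (fun x : R * (R * R) => u k x.1 x.2.2).
Proof. by apply: (@cts3_pt R (u k)); exact: class_C_cts (u_C2 k). Qed.

Let cts_uq k : continuous (fun x : R * (R * R) => uq k x.1 x.2.2).
Proof. by apply: (@cts3_pt R (uq k)); exact: class_C_cts (uq_C1 k). Qed.

Let cts_uqq k : continuous (fun x : R * (R * R) => uqq k x.1 x.2.2).
Proof.
apply: (@cts3_pt R (uqq k)); have [_ [_ _ c _]] := uq_C1 k.
exact: (@class_C_cts _ 0 _ c).
Qed.

Let cts_uqt k : continuous (fun x : R * (R * R) => uqt k x.1 x.2.2).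
Proof.
apply: (@cts3_pt R (uqt k)); have [_ [_ _ _ c]] := uq_C1 k.
exact: (@class_C_cts _ 0 _ c).
Qed.

Let cts_ut k : continuous (fun x : R * (R * R) => partial_t (u k) x.1 x.2.2).
Proof. by apply: (@cts3_pt R (partial_t (u k))); exact: class_C_cts (ut_C1 k). Qed.

Let cP : cts3 P.
Proof. by apply: cts_symbol => [k|]; [exact: cts_u|exact: cts3_p]. Qed.
Let cFq : cts3 Fq.
Proof. by apply: cts_Fpoly => [k|]; [exact: cts_uq|exact: cts3_p]. Qed.
Let cFqq : cts3 Fqq.
Proof. by apply: cts_Fpoly => [k|]; [exact: cts_uqq|exact: cts3_p]. Qed.
Let cFqt : cts3 Fqt.
Proof. by apply: cts_Fpoly => [k|]; [exact: cts_uqt|exact: cts3_p]. Qed.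
Let cPq : cts3 Pq.
Proof. by apply: cts_deriv_Fpoly => [k|]; [exact: cts_uq|exact: cts3_p]. Qed.
Let cPt : cts3 Pt.
Proof. by apply: cts_deriv_Fpoly => [k|]; [exact: cts_ut|exact: cts3_p]. Qed.
Let cPp : cts3 Pp.
Proof. by apply: cts_deriv_symbol => [k|]; [exact: cts_u|exact: cts3_p]. Qed.

Let cdiv (f g : R -> R -> R -> R) : cts3 f -> cts3 g ->
  (forall q p t, g q p t != 0) -> cts3 (fun q p t => f q p t / g q p t).
Proof. by move=> cf cg g0; apply: ctsM => //; apply: ctsV. Qed.

Let cquot (f g : R -> R -> R -> R) : cts3 f -> cts3 g ->
  cts3 (fun q p t => - (f q p t / P q p t - Fq q p t * g q p t / P q p t ^+ 2)).
Proof.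
move=> cf cg; have c1 := cdiv cf cP P_neq0.
have c2 := @cdiv (fun q p t => Fq q p t * g q p t) (fun q p t => P q p t ^+ 2)
  (ctsM cFq cg) (@ctsX R _ _ 2 cP) (fun q p t => expf_neq0 2 (P_neq0 q p t)).
exact: (ctsN (ctsB c1 c2)).
Qed.

Let cW : cts3 W. Proof. exact: (ctsN (cdiv cFq cP P_neq0)). Qed.
Let cWq : cts3 Wq. Proof. exact: (cquot cFqq cPq). Qed.
Let cWt : cts3 Wt. Proof. exact: (cquot cFqt cPt). Qed.
Let cWp : cts3 Wp. Proof. exact: (cquot cPq cPp). Qed.
Let clnP : cts3 (fun q p t => ln (P q p t)).
Proof. by apply: cts_ln => // x; exact: P_gt0. Qed.

(** * Averages over one period *)

Variable q0 : R.
(** The integral over one period in q. *)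
Let J (f : R -> R) := integ q0 (q0 + 1) f.

Let q01 : q0 <= q0 + 1. Proof. by rewrite lerDl. Qed.

(** The derivative of a periodic function has integral zero. *)
Let J_derive (f df : R -> R) : continuous df ->
  (forall q : R, is_derive q 1 f (df q)) -> f (q0 + 1) = f q0 -> J df = 0.
Proof. by move=> cdf fd fE; rewrite /J (integ_derive q01 cdf fd) fE subrr. Qed.

Let P_per q p t : P (q + 1) p t = P q p t.
Proof. by rewrite /P; congr (symbol n _).[p]; apply/funext => k; exact: u_per. Qed.

Let Fq_per q p t : Fq (q + 1) p t = Fq q p t.
Proof. by rewrite /Fq; congr (Fpoly n _).[p]; apply/funext => k; exact: uq_per. Qed.

(** Integrals over one period in q of [ln P], of [W], and of the other
    quantities in their evolution equations; [cp] and [ep] are the p-derivatives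
    of [c] and [e], while [lnPt] and [bt] are the t-derivatives of [a] and [b]. *)
Let a p t := J (fun q => ln (P q p t)).
Let b p t := J (fun q => W q p t).
Let c p t := J (fun q => uq 1%N q t * ln (P q p t)).
Let d p t := J (fun q => W q p t ^+ 2).
Let e p t := J (fun q => uq 1%N q t * W q p t).
Let cp p t := J (fun q => uq 1%N q t * (Pp q p t / P q p t)).
Let ep p t := J (fun q => uq 1%N q t * Wp q p t).
Let lnPt p t := J (fun q => Pt q p t / P q p t).
Let bt p t := J (fun q => Wt q p t).

Let cuq1 : cts3 (fun q _ t => uq 1%N q t).
Proof. by apply: (@cts3_pt R (uq 1%N)); exact: class_C_cts (uq_C1 1%N). Qed.
Let cuqq1 : cts3 (fun q _ t => uqq 1%N q t).
Proof.
apply: (@cts3_pt R (uqq 1%N)); have [_ [_ _ cu _]] := uq_C1 1%N.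
exact: (@class_C_cts _ 0 _ cu).
Qed.
Let clnPp : cts3 (fun q p t => Pp q p t / P q p t).
Proof. exact: (cdiv cPp cP P_neq0). Qed.
Let clnPq : cts3 (fun q p t => Pq q p t / P q p t).
Proof. exact: (cdiv cPq cP P_neq0). Qed.
Let clnPt : cts3 (fun q p t => Pt q p t / P q p t).
Proof. exact: (cdiv cPt cP P_neq0). Qed.
Let cW2 : cts3 (fun q p t => W q p t ^+ 2).
Proof. exact: (@ctsX R _ _ 2 cW). Qed.
Let cc : cts3 (fun q p t => uq 1%N q t * ln (P q p t)).
Proof. exact: (ctsM cuq1 clnP). Qed.
Let ce : cts3 (fun q p t => uq 1%N q t * W q p t).
Proof. exact: (ctsM cuq1 cW). Qed.
Let ccp : cts3 (fun q p t => uq 1%N q t * (Pp q p t / P q p t)).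
Proof. exact: (ctsM cuq1 clnPp). Qed.
Let cep : cts3 (fun q p t => uq 1%N q t * Wp q p t).
Proof. exact: (ctsM cuq1 cWp). Qed.

Let drv_a_t (p t : R) : is_derive t 1 (a p) (lnPt p t).
Proof.
have D (q s : R) : is_derive s 1 (fun t => ln (P q p t)) (Pt q p s / P q p s).
  exact: (@drv_ln R (P q p) s _ (P_gt0 q p s) (drvP_t q p s)).
exact: (@is_derive_integ R (fun q t => ln (P q p t))
  (fun q t => Pt q p t / P q p t) q0 (q0 + 1) t q01
  (fun s => cts3_q p s clnP) D (cts3_qt p clnPt)).
Qed.

Let drv_b_t (p t : R) : is_derive t 1 (b p) (bt p t).
Proof.
exact: (@is_derive_integ R (fun q t => W q p t) (fun q t => Wt q p t)
  q0 (q0 + 1) t q01 (fun s => cts3_q p s cW) (fun q s => drvW_t q p s)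
  (cts3_qt p cWt)).
Qed.

Let drv_c_p (p t : R) : is_derive p 1 (c^~ t) (cp p t).
Proof.
have D (q s : R) : is_derive s 1 (fun p => uq 1%N q t * ln (P q p t))
    (uq 1%N q t * (Pp q s t / P q s t)).
  apply: drvZ.
  exact: (@drv_ln R ((P q)^~ t) s _ (P_gt0 q s t) (drvP_p q s t)).
exact: (@is_derive_integ R (fun q p => uq 1%N q t * ln (P q p t))
  (fun q p => uq 1%N q t * (Pp q p t / P q p t)) q0 (q0 + 1) p q01
  (fun s => cts3_q s t cc) D (cts3_qp t ccp)).
Qed.

Let drv_e_p (p t : R) : is_derive p 1 (e^~ t) (ep p t).
Proof.
exact: (@is_derive_integ R (fun q p => uq 1%N q t * W q p t)
  (fun q p => uq 1%N q t * Wp q p t) q0 (q0 + 1) p q01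
  (fun s => cts3_q s t ce) (fun q s => drvZ (uq 1%N q t) (drvW_p q s t))
  (cts3_qp t cep)).
Qed.

Let lnPt_eq p t : lnPt p t = b p t + cp p t.
Proof.
have Z : J (fun q => p * (Pq q p t / P q p t)) = 0.
  apply: (@J_derive (fun q => p * ln (P q p t))).
  - by apply: ctsM; [exact: cts_cst|exact: (cts3_q p t clnPq)].
  - move=> q; apply: drvZ.
    exact: (@drv_ln R (fun q => P q p t) q _ (P_gt0 q p t) (drvP_q q p t)).
  - by rewrite P_per.
rewrite /lnPt /J (@eq_integ R _ _ _ _ (fun q => lnPtE q p t)).
have cw := cts3_q p t cW; have cu := cts3_q p t ccp.
have cpq : continuous (fun q => p * (Pq q p t / P q p t)).
  by apply: ctsM; [exact: cts_cst|exact: (cts3_q p t clnPq)].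
have cs : continuous (fun q => W q p t + uq 1%N q t * (Pp q p t / P q p t)).
  exact: (ctsD cw cu).
by rewrite (integB _ _ cs cpq) (integD _ _ cw cu) [X in _ - X]Z subr0.
Qed.

Let bt_eq p t : bt p t = ep p t - d p t.
Proof.
have Z1 : J (fun q => p * Wq q p t) = 0.
  have cpW : continuous (fun q => p * Wq q p t).
    by apply: ctsM; [exact: cts_cst|exact: (cts3_q p t cWq)].
  apply: (@J_derive (fun q => p * W q p t) _ cpW
    (fun q => drvZ p (drvW_q q p t))).
  by rewrite /W P_per Fq_per.
have cuqq : continuous (uqq 1%N ^~ t) by exact: (cts3_q p t cuqq1).
have Z2 : J (uqq 1%N ^~ t) = 0.
  exact: (@J_derive (uq 1%N ^~ t) _ cuqq (fun q => drv_uq_q 1%N q t)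
    (uq_per 1%N q0 t)).
have E q : Wt q p t =
  (uq 1%N q t * Wp q p t - W q p t ^+ 2 - p * Wq q p t) - uqq 1%N q t.
  exact: Riccati.
have cu := cts3_q p t cep; have c2 := cts3_q p t cW2.
have c3 : continuous (fun q => p * Wq q p t).
  by apply: ctsM; [exact: cts_cst|exact: (cts3_q p t cWq)].
have c12 := ctsB cu c2; have c123 := ctsB c12 c3.
rewrite /bt /J (@eq_integ R _ _ _ _ E).
rewrite (integB _ _ c123 cuqq) (integB _ _ c12 c3) (integB _ _ cu c2).
by rewrite [X in _ - X]Z2 [X in _ - X - _]Z1 !subr0.
Qed.

(** The integrals of [ln P] and of [W] over one period in q and over [[- N, N]]
    in p. *)
Let Y N t := integ (- N) N (a^~ t).
Let I N t := integ (- N) N (b^~ t).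

(** The first variation of the integral of [ln P]; only boundary terms in the
    momentum appear besides [I]. *)
Let drv_Y (N t : R) : 0 < N -> is_derive t 1 (Y N) (I N t + (c N t - c (- N) t)).
Proof.
move=> N0; have NN : - N <= N by lra.
have cl : continuous (fun x : R * R => lnPt x.1 x.2) by exact: cts3_integ clnPt.
have ca : continuous (fun x : R * R => a x.1 x.2) by exact: cts3_integ clnP.
have cb : continuous (fun x : R * R => b x.1 x.2) by exact: cts3_integ cW.
have cd : continuous (fun x : R * R => cp x.1 x.2) by exact: cts3_integ ccp.
have cbt : continuous (b^~ t) by exact: (@continuous_section R R b t cb).
have cdt : continuous (cp^~ t) by exact: (@continuous_section R R cp t cd).
have H := @is_derive_integ R a lnPt (- N) N t NN
  (fun s => @continuous_section R R a s ca) drv_a_t cl.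
apply: (drv_eq H).
rewrite (@eq_integ R _ _ _ _ (fun p => lnPt_eq p t)) (integD _ _ cbt cdt).
by rewrite (integ_derive NN cdt (fun p => drv_c_p p t)).
Qed.

(** The first variation of the integral of the slope. *)
Let drv_I (N t : R) : 0 < N -> is_derive t 1 (I N)
  ((e N t - e (- N) t) - integ (- N) N (d^~ t)).
Proof.
move=> N0; have NN : - N <= N by lra.
have cl : continuous (fun x : R * R => bt x.1 x.2) by exact: cts3_integ cWt.
have cb : continuous (fun x : R * R => b x.1 x.2) by exact: cts3_integ cW.
have cd : continuous (fun x : R * R => d x.1 x.2) by exact: cts3_integ cW2.
have ce' : continuous (fun x : R * R => ep x.1 x.2) by exact: cts3_integ cep.
have cdt : continuous (d^~ t) by exact: (@continuous_section R R d t cd).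
have cet : continuous (ep^~ t) by exact: (@continuous_section R R ep t ce').
have H := @is_derive_integ R b bt (- N) N t NN
  (fun s => @continuous_section R R b s cb) drv_b_t cl.
apply: (drv_eq H).
rewrite (@eq_integ R _ _ _ _ (fun p => bt_eq p t)) (integB _ _ cet cdt).
by rewrite (integ_derive NN cet (fun p => drv_e_p p t)).
Qed.

(** The lower bound does not depend on the time. *)
Let Y_ge (N t : R) : 0 < N -> 2 * n%:R * (N * ln N - N) <= Y N t.
Proof.
move=> N0; have NN : - N <= N by lra.
have cpq : continuous (fun x : R * R => ln (P x.2 x.1 t)).
  exact: (@cts_comp _ _ _ (fun x : R * R => (x.2, x.1)) (fun y => ln (P y.1 y.2 t))
    (cts_pair (@cts_snd _ _) (@cts_fst _ _)) (cts3_qp t clnP)).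
have -> : Y N t = J (fun q => integ (- N) N (fun p => ln (P q p t))).
  exact: (@Fubini_integ R (fun p q => ln (P q p t)) (- N) N q0 (q0 + 1) NN q01 cpq).
have H : integ q0 (q0 + 1) (cst (2 * n%:R * (N * ln N - N))) <=
    J (fun q => integ (- N) N (fun p => ln (P q p t))).
  apply: le_integ.
  - exact: cts_cst.
  - exact: (@continuous_integ R R (fun p q => ln (P q p t)) (- N) N NN cpq).
  - move=> q _ /=.
    have := @integ_ln_poly_ge R (symbol n (fun k => u k q t)) N
      (symbol_monic _ _) (fun p => P_gt0 q p t) N0.
    by rewrite size_symbol.
apply: le_trans H; rewrite (integ_cst _ q01).
by rewrite addrAC subrr add0r mulr1.
Qed.

(** * Estimates for large momentum, and vanishing of the slope *)

Let bounded_coefficients (t0 T : R) : 0 <= T -> exists B,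
  forall k q t, (k <= n)%N -> q0 <= q <= q0 + 1 -> `|t - t0| <= T ->
  `|u k q t| <= B /\ `|uq k q t| <= B.
Proof.
move=> T0.
(* A single continuous function dominates all the coefficients. *)
pose f q t := \sum_(k < n.+1) (`|u k q t| + `|uq k q t|).
have cn (g : R * R -> R) : continuous g -> continuous (fun x => `|g x|).
  by move=> cg; apply: (cts_comp cg); exact: norm_continuous.
have cf : continuous (fun x : R * R => f x.1 x.2).
  apply: cts_sum => k; apply: ctsD; apply: cn.
    exact: class_C_cts (u_C2 k).
  exact: class_C_cts (uq_C1 k).
have TT : t0 - T <= t0 + T by lra.
have [B fB] := rectangle_bounded q01 TT cf.
exists B => k q t kn qI tT.
have tI : t0 - T <= t <= t0 + T by move: tT; rewrite ler_norml; lra.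
have := fB q t qI tI; rewrite /f (bigD1 (inord k))//= inordK ?ltnS//.
have S0 : 0 <= \sum_(i < n.+1 | i != inord k) (`|u i q t| + `|uq i q t|).
  by apply: sumr_ge0 => i _; rewrite addr_ge0.
have := normr_ge0 (u k q t); have := normr_ge0 (uq k q t).
by move: S0; set s := \sum_(i < _ | _) _; lra.
Qed.

Let ca : continuous (fun x : R * R => a x.1 x.2).
Proof. exact: cts3_integ clnP. Qed.

(** At a fixed time the lower bound is attained up to a constant. The
    derivative in [N] of the difference is [O(1 / N ^+ 2)]. *)
Let Y_le (t0 : R) :
  exists B, forall N, 1 <= N -> Y N t0 <= 2 * n%:R * (N * ln N - N) + B.
Proof.
have [B uB] := @bounded_coefficients t0 0 (lexx 0).
pose C := n.+1%:R * (n%:R * B); pose K := 2 * C + C ^+ 2.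
have B0 : 0 <= B.
  have qI : q0 <= q0 <= q0 + 1 by rewrite lexx q01.
  have tI : `|t0 - t0| <= 0 by rewrite subrr normr0.
  by have [+ _] := uB 0%N q0 t0 (leq0n n) qI tI; exact: le_trans.
have K0 : 0 <= K by rewrite /K addr_ge0 ?sqr_ge0// !mulr_ge0.
have cat : continuous (a^~ t0) by exact: (@continuous_section R R a t0 ca).
have aN (N : R) : 1 <= N -> a N t0 + a (- N) t0 <= 2 * n%:R * ln N + K / N ^+ 2.
  move=> N1.
  have c1 := cts3_q N t0 clnP; have c2 := cts3_q (- N) t0 clnP.
  rewrite /a /J -(integD _ _ c1 c2).
  have -> : 2 * n%:R * ln N + K / N ^+ 2 =
      integ q0 (q0 + 1) (cst (2 * n%:R * ln N + K / N ^+ 2)).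
    by rewrite (integ_cst _ q01) [q0 + 1 - q0]addrAC subrr add0r mulr1.
  apply: le_integ; [exact: (ctsD c1 c2)|exact: cts_cst|].
  move=> q; rewrite in_itv/= => qI.
  have vB k : (k <= n)%N -> `|u k q t0| <= B.
    move=> kn; have tI : `|t0 - t0| <= 0 by rewrite subrr normr0.
    by have [] := uB k q t0 kn qI tI.
  have := @ln_symbol_sum R n (fun k => u k q t0) B n_gt1 n_even vB N N1
    (P_gt0 q N t0) (P_gt0 q (- N) t0).
  by rewrite -/(P q N t0) -/(P q (- N) t0) lerBlDl.
(* The last term makes f nondecreasing on [1, +oo[. *)
pose f N := 2 * n%:R * (N * ln N - N) - Y N t0 - K / N.
exists (- f 1) => N N1.
have fD (x : R) : 1 <= x -> x <= N -> is_derive x 1 f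
    (2 * n%:R * ln x - (a x t0 + a (- x) t0) + K / x ^+ 2).
  move=> x1 _; have x0 : 0 < x by rewrite (lt_le_trans ltr01).
  have D1 := drvB (drvM (drv_id x) (@drv_ln R id x _ x0 (drv_id x))) (drv_id x).
  have D2 := drv_div (lt0r_neq0 x0) (drv_cst K x) (drv_id x).
  have D3 : is_derive x 1 (fun y => Y y t0) (a x t0 + a (- x) t0).
    exact: (integ_sym_is_derive x0 cat).
  have H := drvB (drvB (drvZ (2 * n%:R) D1) D3) D2.
  by apply: (drv_eq H); field; rewrite gt_eqF.
have fN : f 1 <= f N.
  by apply: (drv_ge0_le N1 fD) => x x1 _; have := aN x x1; lra.
have : 0 <= K / N by rewrite divr_ge0// (le_trans ler01).
by move: fN; rewrite {2}/f; lra.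
Qed.

(** The boundary terms are [O(1 / N)], locally uniformly in time. *)
Let boundary_small (t0 T : R) : 0 <= T -> exists2 K, 1 <= K &
  forall N t, K <= N -> `|t - t0| <= T ->
  `|c N t - c (- N) t| <= K / N /\ `|e N t - e (- N) t| <= K / N.
Proof.
move=> T0; have [B uB] := @bounded_coefficients t0 T T0.
have B0 : 0 <= B.
  have qI : q0 <= q0 <= q0 + 1 by rewrite lexx q01.
  have tI : `|t0 - t0| <= T by rewrite subrr normr0.
  by have [+ _] := uB 0%N q0 t0 (leq0n n) qI tI; exact: le_trans.
pose C := n.+1%:R * (n%:R * B).
have C0 : 0 <= C by rewrite !mulr_ge0.
pose X := B * (4 * C); pose Z := B * (2 * (2 * n.+1%:R * B)).
have X0 : 0 <= X by rewrite !mulr_ge0.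
have Z0 : 0 <= Z by rewrite !mulr_ge0.
exists (1 + 2 * C + X + Z); first by lra.
move=> N t NK tT; have N1 : 1 <= N by lra.
have NC : 2 * C <= N by lra.
have N0 : 0 < N by lra.
have nN : `|N| = N by rewrite gtr0_norm.
have nNN : `|- N| = N by rewrite normrN.
have vB q k : q0 <= q <= q0 + 1 -> (k <= n)%N -> `|u k q t| <= B.
  by move=> qI kn; have [] := uB k q t kn qI tT.
have wB q k : q0 <= q <= q0 + 1 -> (k <= n)%N -> `|uq k q t| <= B.
  by move=> qI kn; have [] := uB k q t kn qI tT.
have n1 : (1 <= n)%N by exact: ltnW.
have one (k : R) : k * (q0 + 1 - q0) = k by rewrite addrAC subrr add0r mulr1.
split.
- have c1 := cts3_q N t cc; have c2 := cts3_q (- N) t cc.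
  rewrite /c /J -(integB _ _ c1 c2).
  apply: (@le_trans _ _ (X / N)); last by rewrite ler_pM2r ?invr_gt0//; lra.
  rewrite -[X / N]one; apply: (norm_integ_le q01 (ctsB c1 c2)) => q.
  rewrite in_itv/= => qI; rewrite -mulrBr normrM /X -mulrA.
  apply: ler_pM => //; first exact: wB.
  exact: (@ln_symbol_diff R n (fun k => u k q t) B n_gt1 n_even (vB q ^~ qI) N N1 NC).
- have c1 := cts3_q N t ce; have c2 := cts3_q (- N) t ce.
  rewrite /e /J -(integB _ _ c1 c2).
  apply: (@le_trans _ _ (Z / N)); last by rewrite ler_pM2r ?invr_gt0//; lra.
  rewrite -[Z / N]one; apply: (norm_integ_le q01 (ctsB c1 c2)) => q.
  rewrite in_itv/= => qI; rewrite -mulrBr normrM /Z -mulrA.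
  apply: ler_pM => //; first exact: wB.
  have wr (x : R) : `|x| = N -> `|W q x t| <= 2 * n.+1%:R * B / N.
    move=> xN; rewrite /W normrN.
    exact: (@ratio_symbol_le R n (fun k => u k q t) (fun k => uq k q t) B n_gt1
      n_even (vB q ^~ qI) (wB q ^~ qI) (uq_0 q t) N x N1 NC xN).
  apply: (le_trans (ler_normB _ _)).
  by have := lerD (wr N nN) (wr (- N) nNN); lra.
Qed.

Let W_eq0 (p0 t0 : R) : W q0 p0 t0 = 0.
Proof.
apply/eqP/negPn/negP => W0.
have cd : continuous (fun x : R * R => d x.1 x.2) by exact: cts3_integ cW2.
have cdt t : continuous (d^~ t) by exact: (@continuous_section R R d t cd).
have d0 p t : 0 <= d p t by apply: integ_ge0 => q; exact: sqr_ge0.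
pose M := `|p0| + 1.
have M0 : 0 < M by rewrite /M ltr_wpDl.
have MM : - M <= M by lra.
pose D t := integ (- M) M (d^~ t).
have Dt0 : 0 < D t0.
  apply: (@integ_gt0 R _ _ _ p0); rewrite /M.
  - by have := ler_norm (- p0); rewrite normrN; lra.
  - by have := ler_norm p0; lra.
  - exact: cdt.
  - by move=> p; exact: d0.
  - apply: (@integ_gt0 R _ _ _ q0) => //.
    + by rewrite ltrDl.
    + exact: (cts3_q p0 t0 cW2).
    + by move=> q; exact: sqr_ge0.
    + by rewrite exprn_even_gt0.
have cD : continuous D by exact: (@continuous_integ R R d (- M) M MM cd).
have [r r0 rD] := continuous_ge_half cD Dt0.
have [B YB] := Y_le t0.
(* During the time r the function I loses at least D t0 / 2 * r. The time T is
   long enough for Y to drop by |B| + 2 on this account, and N is large enough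
   for the boundary terms to contribute at most 1 over the time T. *)
pose T := r + (`|B| + 2) / (D t0 / 2 * r).
have Dr : 0 < D t0 / 2 * r by rewrite mulr_gt0// divr_gt0.
have rT : r <= T by rewrite /T lerDl divr_ge0 ?ltW// addr_ge0.
have T0 : 0 <= T by rewrite (le_trans _ rT)// ltW.
have [K K1 KB] := @boundary_small t0 T T0.
have K0 : 0 < K by exact: lt_le_trans K1.
pose N := K + M + K * ((1 + T) * T).
have X0 : 0 <= K * ((1 + T) * T) by rewrite mulr_ge0 ?(ltW K0)// mulr_ge0// addr_ge0.
have NK : K <= N by rewrite /N -addrA lerDl addr_ge0// ltW.
have NM : M <= N by rewrite /N addrAC lerDr addr_ge0// ltW.
have N0 : 0 < N by exact: lt_le_trans NK.
have N1 : 1 <= N by exact: le_trans NK.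
have h0 : 0 <= K / N by rewrite divr_ge0// ltW.
have h1 : K / N * (1 + T) * T <= 1.
  have -> : K / N * (1 + T) * T = K * ((1 + T) * T) / N by field; rewrite gt_eqF.
  by rewrite ler_pdivrMr// mul1r /N lerDr addr_ge0// ltW.
have DN t : D t <= integ (- N) N (d^~ t).
  have NMn : - N <= - M by rewrite lerN2.
  exact: (subitv_integ_le NMn MM NM (cdt t) (fun p => d0 p t)).
have D0 t : 0 <= D t by apply: integ_ge0 => p; exact: d0.
have [|||t Yt] := @almost_concave_drop R (Y N) (I N) _ _ t0 T r (D t0 / 2) (K / N)
  (ltW r0) rT h0 (fun t _ => drv_Y t N0) (fun t _ => drv_I t N0).
- by move=> t tT; rewrite addrAC subrr add0r; have [] := KB N t NK tT.
- move=> t tT; have [_] := KB N t NK tT; rewrite ler_norml => /andP[_ eK].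
  by rewrite lerBlDr; apply: (le_trans eK); rewrite lerDl (le_trans (D0 t) (DN t)).
- move=> t tr; have tT := le_trans tr rT.
  have [_] := KB N t NK tT; rewrite ler_norml => /andP[_ eK].
  exact: lerB eK (le_trans (rD t tr) (DN t)).
have E : D t0 / 2 * r * (T - r) = `|B| + 2.
  by rewrite /T addrAC subrr add0r mulrCA divff ?mulr1// gt_eqF.
rewrite E in Yt.
exact: drop_contradiction (Y_ge t N0) Yt (YB N N1) h1 (ler_norm B).
Qed.

(** For an elliptic system, that is, one with positive symbol, the slope [W]
    vanishes, so [F] does not depend on q. *)
Lemma elliptic_partial_q_eq0 (k : nat) (t : R) : (k <= n)%N ->
  partial_q (u k) q0 t = 0.
Proof.
apply: (@Fpoly_eq0 R n (fun k => partial_q (u k) q0 t)) => p.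
have /eqP := W_eq0 p t; rewrite /W oppr_eq0 mulf_eq0 invr_eq0.
by rewrite (negbTE (P_neq0 _ _ _)) orbF => /eqP.
Qed.

End EllipticSystem.

(** * Eigenvalues of the system matrix *)

Section SystemMatrix.
Context {R : realType}.

(** The row vector of decreasing powers of [p] is an eigenvector. *)
Lemma root_symbol_eigenvalue n (u0 : R) (v : 'cV[R]_n) (p : R) : (0 < n)%N ->
  root (symbol n (ext u0 v)) p -> eigenvalue (system_matrix u0 v) (- p).
Proof.
move=> n0 /rootP; rewrite hornerD hornerXn horner_deriv_Fpoly => /eqP.
rewrite addrC addr_eq0 big_ord_recr/= subnn mul0r mulr0 addr0 => /eqP E.
apply/eigenvalueP; exists (\row_j p ^+ (n.-1 - j)); last first.
  have ln : (n.-1 < n)%N by rewrite prednK.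
  apply/eqP => /rowP/(_ (Ordinal ln)); rewrite !mxE/= subnn expr0.
  by move/eqP; rewrite oner_eq0.
apply/rowP => j; rewrite !mxE.
have [j0|j0] := eqVneq (j : nat) 0%N.
  rewrite j0 subn0 mulNr -exprS prednK// -E; apply: eq_bigr => i _.
  rewrite !mxE j0 eqxx.
  have -> : (n - i).-1 = (n.-1 - i)%N by lia.
  by ring.
have jn : (j.-1 < n)%N by rewrite (leq_ltn_trans (leq_pred j)).
rewrite (bigD1 (Ordinal jn))//= !mxE/= (negbTE j0) prednK ?lt0n// eqxx.
rewrite big1 ?addr0 => [|i ij].
  rewrite mulrN1 mulNr -exprS; congr (- (_ ^+ _)).
  by have := ltn_ord j; move: j0; lia.
rewrite !mxE (negbTE j0); case: eqP => [ji|_]; last by rewrite mulr0.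
by case/eqP: ij; apply: val_inj; rewrite /= ji.
Qed.

(** A symbol without roots has constant sign, and it is positive far away. *)
Lemma symbol_gt0 n (v : nat -> R) : ~~ odd n -> (1 < n)%N ->
  (forall x, ~~ root (symbol n v) x) -> forall x, 0 < (symbol n v).[x].
Proof.
move=> n_even n1 nr x; rewrite ltNge; apply/negP => x0.
pose B := \sum_(k < n.+1) `|v k|.
have vB k : (k <= n)%N -> `|v k| <= B.
  move=> kn; rewrite /B (bigD1 (inord k))//= inordK ?ltnS// lerDl.
  exact: sumr_ge0.
pose C := n.+1%:R * (n%:R * B).
have C0 : 0 <= C by rewrite !mulr_ge0// sumr_ge0.
pose N := 1 + 2 * C + `|x|.
have nx := normr_ge0 x.
have N1 : 1 <= N by rewrite /N; lra.
have NC : 2 * C <= N by rewrite /N; lra.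
have xN : x <= N by have := ler_norm x; rewrite /N; lra.
have nN : `|N| = N by rewrite ger0_norm// (le_trans ler01).
have := @symbol_ge R n v B n1 n_even vB N N N1 NC nN => HN.
have P0 : 0 <= (symbol n v).[N].
  by apply: le_trans HN; rewrite divr_ge0// exprn_ge0// (le_trans ler01).
(* By the intermediate value theorem there is a root between x and N. *)
have [|y _] := @poly_ivt R (symbol n v) x N xN; first by rewrite x0.
by apply/negP.
Qed.

Lemma class_C_cst m (k : R) : class_C m (fun _ _ : R => k).
Proof.
elim: m k => [|m IH] k; first by split=> // x; exact: cvg_cst.
have pq : partial_q (fun _ _ : R => k) = fun _ _ => 0.
  by apply/funext => q; apply/funext => t; rewrite /partial_q partial1of2E derive_cst.
have pt : partial_t (fun _ _ : R => k) = fun _ _ => 0.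
  by apply/funext => q; apply/funext => t; rewrite /partial_t derive1_cst.
split; first by move=> x; exact: cvg_cst.
by rewrite pq pt; split; [| |exact: IH|exact: IH] => *; exact: derivable_cst.
Qed.

End SystemMatrix.

Theorem theorem3 (R : realType) (n : nat) (u0 : R) (U : R -> R -> 'cV[R]_n)
  (n_even : ~~ odd n) (n_gt2 : (2 < n)%N)
  (U_periodic : forall q t : R, U (q + 1) t = U q t)
  (U_smooth : forall k : 'I_n, smooth (fun q t => U q t k 0))
  (U_solution : solves_system u0 U)
  (no_real_eigenvalue : forall q t a : R,
     ~~ eigenvalue (system_matrix u0 (U q t)) a)
  (bounded_integral : exists K : R, 0 < K /\ forall t : R,
     (\int[lebesgue_measure]_(q in `[0%R, 1%R])
        ((partial_q (field_component u0 U 1) q t) ^+ 2)%R%:E < K%:E)%E) :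
  forall k : 'I_n, exists c : R, forall q t : R, U q t k 0 = c.
Proof.
have n1 : (1 < n)%N by exact: ltnW.
have n0 : (0 < n)%N by exact: ltnW.
pose u := field_component u0 U.
have uE (i : 'I_n) : u i.+1 = fun q t => U q t i 0.
  by apply/funext => q; apply/funext => t; exact: ext_ord.
have u_gt k : (n < k)%N -> u k = fun _ _ => 0.
  by move=> nk; apply/funext => q; apply/funext => t; exact: ext_gt.
have uC k : class_C 2 (u k).
  case: k => [|k]; first exact: class_C_cst.
  have [kn|nk] := ltnP k n; first by rewrite (uE (Ordinal kn)); exact: U_smooth.
  by rewrite u_gt//; exact: class_C_cst.
have P0 q p t : 0 < (symbol n (fun k => u k q t)).[p].
  apply: symbol_gt0 => // x; apply/negP => rx.
  by have /negP := no_real_eigenvalue q t (- x); apply; exact: root_symbol_eigenvalue.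
have uper k q t : u k (q + 1) t = u k q t.
  by rewrite /u /field_component U_periodic.
have uS q t : u n.+1 q t = 0 by rewrite u_gt.
have Z k q t : (k <= n)%N -> partial_q (u k) q t = 0.
  exact: (@elliptic_partial_q_eq0 R n u0 u n1 n_even uC uper (fun _ _ => erefl)
    uS U_solution P0).
have ZS q t : partial_q (u n.+1) q t = 0.
  by rewrite u_gt// /partial_q partial1of2E derive_cst.
move=> i; exists (U 0 0 i 0) => q t.
have in_ : (i < n)%N by exact: ltn_ord.
have D1 (s : R) : is_derive s 1 ((u i.+1)^~ t) (0 : R).
  by rewrite -(Z i.+1 s t in_); exact: class_C_drv_q (uC i.+1).
have D2 (s : R) : is_derive s 1 (u i.+1 0) (0 : R).
  apply: (drv_eq (class_C_drv_t 0 s (uC i.+1))).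
  rewrite (U_solution i.+1 0 s); last by rewrite /= in_.
  rewrite [partial_q _ 0 s](Z 1%N)// mulr0 sub0r.
  have [i1|i1] := ltnP i.+1 n; first by rewrite [partial_q _ 0 s]Z ?oppr0.
  have -> : i.+2 = n.+1 by congr _.+1; apply/eqP; rewrite eqn_leq in_.
  by rewrite [partial_q _ 0 s]ZS oppr0.
have E1 := is_derive_0_is_cst q 0 D1.
have E2 := is_derive_0_is_cst t 0 D2.
have uv x y : U x y i 0 = u i.+1 x y by rewrite uE.
by rewrite !uv; exact: etrans E1 E2.
Qed.
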